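(* Let $\mathbb{F}$ be a field, let $d$ be an integer with $0\le d\le 5$, and let $\{\theta_i\}_{i=0}^d$, $\{\theta^*_i\}_{i=0}^d$ be scalars in $\mathbb{F}$ such that $\theta_i\ne\theta_j$ and $\theta^*_i\ne\theta^*_j$ for $i\ne j$, and such that the expressions $\frac{\theta_{i-2}-\theta_{i+1}}{\theta_{i-1}-\theta_i}$ and $\frac{\theta^*_{i-2}-\theta^*_{i+1}}{\theta^*_{i-1}-\theta^*_i}$ are equal and independent of $i$ for $2\le i\le d-1$. Then the $\mathbb{F}$-algebra homomorphism $\mu:\mathbb{F}[x_1,\dots,x_d]\to e^*_0Te^*_0$ sending $x_i\mapsto e^*_0\tau_i(a)e^*_0$ ($1\le i\le d$) is an isomorphism.
   Context: $\tau_i(\lambda)=(\lambda-\theta_0)(\lambda-\theta_1)\cdots(\lambda-\theta_{i-1})$. $T$ is the associative $\mathbb{F}$-algebra with $1$ generated by $a,e_0,\dots,e_d,a^*,e^*_0,\dots,e^*_d$ with relations $e_ie_j=\delta_{ij}e_i$, $e^*_ie^*_j=\delta_{ij}e^*_i$ ($0\le i,j\le d$), $\sum_{i=0}^de_i=1$, $\sum_{i=0}^de^*_i=1$, $a=\sum_i\theta_ie_i$, $a^*=\sum_i\theta^*_ie^*_i$, and $e^*_ia^ke^*_j=0$, $e_i{a^*}^ke_j=0$ whenever $0\le i,j,k\le d$ and $k<|i-j|$. $\mathbb{F}[x_1,\dots,x_d]$ is the polynomial algebra in commuting indeterminates. $e^*_0Te^*_0$ is a commutative $\mathbb{F}$-algebra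 with identity $e^*_0$ generated by $e^*_0\tau_i(a)e^*_0$ ($1\le i\le d$), so $\mu$ is a well-defined surjective algebra homomorphism. *)

(* Defs.v *)
From HB Require Import structures.
From mathcomp Require Import all_boot all_order all_algebra.
From mathcomp Require Import mpoly.
Set Implicit Arguments. Unset Strict Implicit. Unset Printing Implicit Defensive.
Import Order.TTheory GRing.Theory Num.Theory.
Local Open Scope ring_scope.

Section LP.
Variables (F : fieldType) (d : nat).

Definition tau (A : lalgType F) (th : nat -> F) (i : nat) (x : A) : A :=
  \prod_(l < i) (x - (th l)%:A).

Definition LP_rels (A : algType F) (th ths : nat -> F)
    (a : A) (e : nat -> A) (as_ : A) (es : nat -> A) : Prop :=
  (forall i j : 'I_d.+1, e i * e j = if i == j then e i else 0) /\
  (forall i j : 'I_d.+1, es i * es j = if i == j then es i else 0) /\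
  \sum_(i < d.+1) e i = 1 /\
  \sum_(i < d.+1) es i = 1 /\
  a = \sum_(i < d.+1) th i *: e i /\
  as_ = \sum_(i < d.+1) ths i *: es i /\
  (forall i j k : 'I_d.+1, (k < `|i - j|)%N ->
          es i * a ^+ k * es j = 0 /\ e i * as_ ^+ k * e j = 0).

Inductive gen := GA | GE of 'I_d.+1 | GAs | GEs of 'I_d.+1.

Definition gen_val (A : algType F) (a : A) (e : nat -> A) (as_ : A)
    (es : nat -> A) (g : gen) : A :=
  match g with GA => a | GE i => e i | GAs => as_ | GEs i => es i end.

(* T (with the given elements) is the F-algebra generated by
   a, e_0..e_d, as, es_0..es_d subject to the relations LP_rels:
   the relations hold, the generators generate T as an F-algebra, and
   for every F-algebra B with elements satisfying the relations there is an
   F-algebra homomorphism T -> B mapping generators to generators. *)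
Definition LP_presented (th ths : nat -> F) (T : algType F)
    (a : T) (e : nat -> T) (as_ : T) (es : nat -> T) : Prop :=
  [/\ LP_rels th ths a e as_ es,
      (forall t : T, exists s : seq (F * seq gen),
          t = \sum_(w <- s) w.1 *: \prod_(g <- w.2) gen_val a e as_ es g) &
      (forall (B : algType F) (b : B) (f : nat -> B) (bs : B) (fs : nat -> B),
          LP_rels th ths b f bs fs ->
          exists phi : T -> B,
            [/\ (forall x y, phi (x + y) = phi x + phi y),
                (forall (c : F) x, phi (c *: x) = c *: phi x),
                (forall x y, phi (x * y) = phi x * phi y),
                phi 1 = 1 &
                (forall g, phi (gen_val a e as_ es g) = gen_val b f bs fs g)])].

(* mu : F[x_1..x_d] -> es_0 T es_0, x_i |-> es_0 tau_i(a) es_0 (1 <= i <= d);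
   variable x_{j+1} is indexed by j : 'I_d. The constant 1 maps to es_0. *)
Definition mu (th : nat -> F) (T : algType F) (a : T) (es : nat -> T)
    (p : {mpoly F[d]}) : T :=
  \sum_(m <- msupp p)
     p@_m *: (es 0%N * \prod_(j < d) (es 0%N * tau th j.+1 a * es 0%N) ^+ (m j)).

End LP.

(* Main.v *)
(** Surjectivity. A product of generators cut down by [e*_0] on both sides is a
    combination of words [e*_0 e_r1 e*_j1 e_r2 e*_j2 ... e*_0]. At a place where
    the sequence [0, j1, j2, ..., 0] is not convex, the relations rewrite
    [e*_i e_r e*_j e_s e*_k] as a combination of such products with
    [2 j <= i + k], because a band matrix whose rows and columns annihilate
    enough polynomials vanishes. Hence the words with all [j = 0] span, and they
    are products of the elements [e*_0 e_r e*_0], which commute.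

    Injectivity. Over an extension of [K = F(q)] the eigenvalues
    [u q^(2i-d) + w q^(d-2i)] are realised on a [d]-fold tensor product of
    two-dimensional modules (evaluation modules of the quantum affine algebra of
    sl_2). Each factor carries a new transcendental parameter, and this makes the
    scalars by which the [e*_0 tau_i(a) e*_0] act on the line [e*_0]
    algebraically independent. The place of [K] sending [q^2 + 1 + q^-2] to
    [beta] sends these eigenvalues, up to a translation and for suitable [u] and
    [w], to the [theta_i]. Let [O] be the ring of this place, [m] its ideal, and
    [T_O] the [O]-span of the words in the generic operators. Then
    [T_O / m T_O] satisfies the relations of [T], and the first part, which holds
    over [O], shows that [e*_0 (m T_O) e*_0] contains only polynomials in the
    corners with coefficients in [m]. A polynomial killed by [mu] lifts to such
    a polynomial, so its coefficients vanish. *)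
Require Import Defs.
From HB Require Import structures.
From mathcomp Require Import all_boot all_order all_algebra.
From mathcomp Require Import mpoly zify ring.
From Stdlib Require Import ClassicalEpsilon.
Set Implicit Arguments. Unset Strict Implicit. Unset Printing Implicit Defensive.
Import Order.TTheory GRing.Theory Num.Theory.
Local Open Scope ring_scope.

(** * Band matrices over a subring *)

Section Span.
Variables (L : fieldType) (R : algType L).

(** [T] is known only through its presentation, so injectivity needs modules, and no single formula
    yields them for every [beta]. At [q^2 = 1], for instance, [u q^(2i-d) + w q^(d-2i)] does not
    depend on [i], and at other roots of unity the quantum integers of the construction can vanish.
    Keeping [q] an indeterminate and reaching [beta] by specialization treats all values of [beta]
    and all characteristics alike.

    The price is that the words in the generic operators span an [O]-module about which nothing is
    known. What replaces a basis of it is an integral form of the spanning argument. For this reason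
    the band matrix lemmas concern a subring [S] in which the differences of eigenvalues are units,
    and membership in an arbitrary [S]-submodule [Q] instead of vanishing.

    The band relations are not checked directly on the tensor product. They follow from two cubic
    relations between the operators, which do pass to a tensor product and which, between
    eigenvectors, allow only neighbouring indices to interact. *)

Definition subringP (S : L -> Prop) : Prop :=
  [/\ S 1, (forall x y, S x -> S y -> S (x - y)) &
      (forall x y, S x -> S y -> S (x * y))].

Definition submodP (S : L -> Prop) (Q : R -> Prop) : Prop :=
  [/\ Q 0, (forall x y, Q x -> Q y -> Q (x + y)) &
      (forall c x, S c -> Q x -> Q (c *: x))].

(** [P] is a mere predicate, so that one notion covers coefficients in a ring and coefficients in an
    ideal of it, where [1] is missing and a generator need not lie in the span. *)
Inductive span (P : L -> Prop) (G : R -> Prop) : R -> Prop :=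
| span_nil : span P G 0
| span_cons c g x : P c -> G g -> span P G x -> span P G (c *: g + x).

Lemma span_add P G x y : span P G x -> span P G y -> span P G (x + y).
Proof.
elim=> [|c g z Pc Gg _ IH] Sy; first by rewrite add0r.
by rewrite -addrA; apply: span_cons => //; apply: IH.
Qed.

Lemma span_gen (P : L -> Prop) (G : R -> Prop) c g :
  P c -> G g -> span P G (c *: g).
Proof. by move=> Pc Gg; rewrite -[_ *: _]addr0; apply: span_cons => //; constructor. Qed.

Lemma span_scale (P P' P'' : L -> Prop) G c x :
  (forall a b, P a -> P' b -> P'' (a * b)) ->
  P c -> span P' G x -> span P'' G (c *: x).
Proof.
move=> PP Pc; elim=> [|b g z Pb Gg _ IH]; first by rewrite scaler0; constructor.
by rewrite scalerDr scalerA; apply: span_cons => //; apply: PP.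
Qed.

Lemma span_ind_mod (P : L -> Prop) (G Q : R -> Prop) x :
  Q 0 -> (forall y z, Q y -> Q z -> Q (y + z)) ->
  (forall c g, P c -> G g -> Q (c *: g)) -> span P G x -> Q x.
Proof. by move=> Q0 QD QZ; elim=> // c g z Pc Gg _ Qz; apply: QD => //; apply: QZ. Qed.

Section Scalars.
Variable S : L -> Prop.
Hypothesis Ssub : subringP S.

Lemma subring0 : S 0.
Proof. by case: Ssub => S1 SB _; rewrite -(subrr 1); apply: SB. Qed.

Lemma subringN x : S x -> S (- x).
Proof. by case: Ssub => _ SB _ Sx; rewrite -sub0r; apply: SB => //; apply: subring0. Qed.

Lemma subring_prod (I : Type) (r : seq I) (P : pred I) (F : I -> L) :
  (forall i, P i -> S (F i)) -> S (\prod_(i <- r | P i) F i).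
Proof. by case: Ssub => S1 _ SM; apply: big_ind. Qed.

Lemma submod_span G : submodP S (span S G).
Proof.
split; first by constructor.
  by move=> x y; apply: span_add.
by move=> c x Sc; apply: span_scale Sc; case: Ssub.
Qed.

Variable Q : R -> Prop.
Hypothesis Qmod : submodP S Q.

Lemma submodN x : Q x -> Q (- x).
Proof.
case: Qmod => _ _ QZ Qx; rewrite -scaleN1r; apply: QZ => //.
by apply: subringN; case: Ssub.
Qed.

Lemma submod_sum (I : Type) (r : seq I) (P : pred I) (F : I -> R) :
  (forall i, P i -> Q (F i)) -> Q (\sum_(i <- r | P i) F i).
Proof. by case: Qmod => Q0 QD _; apply: big_ind. Qed.

Lemma submod_unit c x : S c^-1 -> c != 0 -> Q (c *: x) -> Q x.
Proof.
by case: Qmod => _ _ QZ Sc c0 /(QZ _ _ Sc); rewrite scalerA mulVf // scale1r.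
Qed.

Variables (d : nat) (th : nat -> L).
Hypothesis Sth : forall i, (i <= d)%N -> S (th i).
Hypothesis Sinv : forall i j, (i <= d)%N -> (j <= d)%N -> i != j ->
  th i - th j != 0 /\ S (th i - th j)^-1.

Definition roots_poly (r : seq nat) : {poly L} := \prod_(l <- r) ('X - (th l)%:P).

Lemma roots_polyE r x : (roots_poly r).[x] = \prod_(l <- r) (x - th l).
Proof. by rewrite horner_prod; apply: eq_bigr => l _; rewrite hornerXsubC. Qed.

Lemma size_roots_poly r : size (roots_poly r) = (size r).+1.
Proof. exact: size_prod_XsubC. Qed.

Lemma roots_poly_root r i : i \in r -> (roots_poly r).[th i] = 0.
Proof. by move=> ir; rewrite roots_polyE (big_rem i ir) /= subrr mul0r. Qed.

Lemma roots_poly_scalar r i : all (fun l => l <= d)%N r -> (i <= d)%N ->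
  S (roots_poly r).[th i].
Proof.
move=> rd id; rewrite roots_polyE big_seq; apply: subring_prod => l lr.
by case: Ssub => _ SB _; apply: SB; apply: Sth => //; apply: (allP rd).
Qed.

Lemma roots_poly_unit r i : all (fun l => l <= d)%N r -> (i <= d)%N ->
  i \notin r -> (roots_poly r).[th i] != 0 /\ S (roots_poly r).[th i]^-1.
Proof.
move=> rd id ir; rewrite roots_polyE -prodfV; split.
  rewrite prodf_seq_neq0; apply/allP => l lr /=.
  by case: (Sinv id (allP rd l lr)) => //; apply: contraNneq ir => ->.
rewrite big_seq; apply: subring_prod => l lr.
by case: (Sinv id (allP rd l lr)) => //; apply: contraNneq ir => ->.
Qed.

(** Only the [n] entries in the window [a, a + n) are in question. For [r] in it, a polynomial of
    degree < n that vanishes at the other points of the window isolates [B r], and its value at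
    [th r] is a unit of [S]. *)
Lemma submod_lagrange (a n : nat) (B : nat -> R) :
  (forall p : {poly L}, (size p <= n)%N -> \sum_(r < d.+1) p.[th r] *: B r = 0) ->
  (forall r, (r <= d)%N -> (r < a)%N || (a + n <= r)%N -> Q (B r)) ->
  forall r, (r <= d)%N -> Q (B r).
Proof.
move=> Bmom Bout r rd.
case: (boolP ((r < a)%N || (a + n <= r)%N)) => [/Bout|rin]; first exact.
pose s := [seq l <- iota a n | (l != r) && (l <= d)%N].
have sd : all (fun l => l <= d)%N s by apply/allP => l; rewrite mem_filter => /andP[/andP[]].
have sr : r \notin s by rewrite mem_filter eqxx.
have szs : (size s < n)%N.
  rewrite size_filter -[X in (_ < X)%N](size_iota a n) ltn_neqAle count_size andbT -all_count.
  apply/negP => /allP /(_ r); rewrite mem_iota eqxx /= => H.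
  by have := H ltac:(lia).
have /Bmom : (size (roots_poly s) <= n)%N by rewrite size_roots_poly.
have [c0 Sc] := roots_poly_unit sd rd sr.
rewrite (bigD1 (inord r)) //= inordK // => /eqP; rewrite addr_eq0 => /eqP E.
apply: (submod_unit Sc c0); rewrite E; apply: submodN; apply: submod_sum => l lr.
case: (boolP ((l : nat) \in s)) => [ls|].
  by rewrite roots_poly_root // scale0r; case: Qmod.
have ld : (l <= d)%N by rewrite -ltnS.
rewrite mem_filter ld mem_iota => ls.
case: Qmod => _ _; apply; first exact: roots_poly_scalar.
apply: Bout => //.
have lr' : (l : nat) != r.
  by apply: contraNneq lr => E1; rewrite -val_eqE /= inordK // E1.
by move: ls; rewrite lr' /=; lia.
Qed.

(* A band matrix of half-width [w] whose columns annihilate polynomials of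
   degree < [al] and whose rows annihilate degree < [be] vanishes when
   [2 w < al + be].  Writing the columns in terms of the divided differences on
   the windows [t, t + al], the coefficient of window [t] is the vector [b t],
   supported on [t + al - w, t + w]. *)
Lemma submod_band (w al be : nat) (B : nat -> nat -> R) :
  (w.*2 < al + be)%N ->
  (forall r s, (r <= d)%N -> (s <= d)%N -> (r + w < s)%N || (s + w < r)%N ->
     Q (B r s)) ->
  (forall s (p : {poly L}), (s <= d)%N -> (size p <= al)%N ->
     \sum_(r < d.+1) p.[th r] *: B r s = 0) ->
  (forall r (p : {poly L}), (r <= d)%N -> (size p <= be)%N ->
     \sum_(s < d.+1) p.[th s] *: B r s = 0) ->
  forall r s, (r <= d)%N -> (s <= d)%N -> Q (B r s).
Proof.
case: al => [|al] wab Bband Bcol Brow.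
  (* Without column conditions, a row has at most [2 w + 1 <= be] entries inside the band. *)
  move=> r s rd; apply: (@submod_lagrange (r - w) be); first by move=> p; apply: Brow.
  by move=> l ld H; apply: Bband => //; lia.
(* From here on [al] is one less than in the statement: the windows are [t, t + al + 1], and [q t]
   vanishes at their [al] interior points. *)
pose q t := roots_poly (iota t.+1 al).
pose b t s := \sum_(r < d.+1 | (t + al.+1 <= r)%N) (q t).[th r] *: B r s.
have qS t r : (t + al < d.+1)%N -> (r <= d)%N -> S (q t).[th r].
  move=> td rd; apply: roots_poly_scalar => //; apply/allP => l.
  by rewrite mem_iota; lia.
have Qb t s : (t + al.+1 <= d)%N -> (s <= d)%N -> Q (b t s).
  move=> td; apply: (@submod_lagrange (t + al.+1 - w) be).
    move=> p sp; rewrite /b.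
    under eq_bigr do rewrite scaler_sumr.
    rewrite exchange_big big1 //= => r _.
    under eq_bigr do rewrite scalerA mulrC -scalerA.
    by rewrite -scaler_sumr Brow ?scaler0 // -ltnS.
  move=> l ld out.
  (* Left of the support every term of the tail sum [r > t + al] is outside the band. Right of it,
     the column condition with [q t] turns the tail into minus the sum over [r <= t], whose terms
     are outside the band. *)
  have [lw|lw] := ltnP (l + w) (t + al.+1).
    apply: submod_sum => r rt; have rd := ltn_ord r.
    case: Qmod => _ _; apply; first by apply: qS; lia.
    by apply: Bband; lia.
  have sq : (size (q t) <= al.+1)%N by rewrite size_roots_poly size_iota.
  have /eqP := Bcol l (q t) ld sq.
  rewrite (bigID (fun r : 'I__ => (t + al.+1 <= r)%N)) /= addr_eq0 => /eqP E.
  rewrite /b E; apply: submodN; apply: submod_sum => r rt; have rd := ltn_ord r.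
  have [rt'|rt'] := leqP r t.
    case: Qmod => _ _; apply; first by apply: qS; lia.
    by apply: Bband; lia.
  rewrite roots_poly_root ?scale0r; first by case: Qmod.
  by rewrite mem_iota; lia.
(* In the window whose right end is [r], the entry [B r s] has a unit coefficient and the other
   terms of [b] lie in rows beyond [r]. *)
have Qstep r s : (al.+1 <= r)%N -> (r <= d)%N -> (s <= d)%N ->
    (forall l, (r < l)%N -> (l <= d)%N -> Q (B l s)) -> Q (B r s).
  move=> ra rd sd IH; pose t := (r - al.+1)%N.
  have qu : all (fun l => l <= d)%N (iota t.+1 al).
    by apply/allP => l; rewrite mem_iota /t; lia.
  have qr : r \notin iota t.+1 al by rewrite mem_iota /t; lia.
  have [c0 Sc] := roots_poly_unit qu rd qr.
  apply: (submod_unit Sc c0).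
  have rt : (t + al.+1 <= r)%N by rewrite /t; lia.
  have : Q (b t s) by apply: Qb => //; lia.
  rewrite /b (bigD1 (inord r)) /= ?inordK //.
  set x := _ *: _; set y := \sum_(i < _ | _) _ => Qx.
  rewrite -[x](addrK y).
  case: (Qmod) => _ QD QZ; apply: QD => //; apply: submodN; apply: submod_sum => l /andP[lr ln].
  have ld := ltn_ord l.
  have {}ln : (l : nat) != r.
    by apply: contraNneq ln => E1; rewrite -val_eqE /= inordK // E1.
  by apply: QZ; [apply: qS; lia | apply: IH; lia].
have Qhigh r s : (al.+1 <= r)%N -> (r <= d)%N -> (s <= d)%N -> Q (B r s).
  move: {2}(d - r)%N (leqnn (d - r)%N) => n.
  elim: n r s => [|n IH] r s dr ra rd sd; apply: Qstep => // l lr ld.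
    by lia.
  by apply: IH; lia.
(* The [al + 1] rows left over are settled by as many column conditions. *)
move=> r s rd sd; have [ra|ra] := ltnP r al.+1; last exact: Qhigh.
apply: (@submod_lagrange 0 al.+1 (fun r => B r s)) => //; first by move=> p; apply: Bcol.
by move=> l ld H; apply: Qhigh => //; lia.
Qed.

End Scalars.
End Span.

(** * Words in the idempotents *)

Section Words.
Variables (L : fieldType) (R : algType L) (d : nat).

Definition orthogonal_idempotents (e : nat -> R) :=
  forall i j, (i <= d)%N -> (j <= d)%N -> e i * e j = if i == j then e i else 0.

(** The relations [e_r as^k e_s = 0] for k < |r - s|, extended from powers of [as] to polynomials in
    it, whose roots can then be chosen. *)
Definition poly_vanish (ths : nat -> L) (e es : nat -> R) :=
  forall r s (p : {poly L}), (r <= d)%N -> (s <= d)%N ->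
    (size p + r <= s)%N || (size p + s <= r)%N ->
    \sum_(l < d.+1) p.[ths l] *: (e r * es l * e s) = 0.

Variables (th ths : nat -> L) (e es : nat -> R).
Hypothesis e_orth : orthogonal_idempotents e.
Hypothesis es_orth : orthogonal_idempotents es.
Hypothesis sum_e : \sum_(i < d.+1) e i = 1.
Hypothesis sum_es : \sum_(i < d.+1) es i = 1.
Hypothesis e_van : poly_vanish ths e es.
Hypothesis es_van : poly_vanish th es e.

Let es_idem i : (i <= d)%N -> es i * es i = es i.
Proof. by move=> id; rewrite es_orth // eqxx. Qed.

Section Scalars.
Variable S : L -> Prop.
Hypothesis Ssub : subringP S.
Hypothesis Sth : forall i, (i <= d)%N -> S (th i).
Hypothesis Sths : forall i, (i <= d)%N -> S (ths i).
Hypothesis Sth_inv : forall i j, (i <= d)%N -> (j <= d)%N -> i != j ->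
  th i - th j != 0 /\ S (th i - th j)^-1.
Hypothesis Sths_inv : forall i j, (i <= d)%N -> (j <= d)%N -> i != j ->
  ths i - ths j != 0 /\ S (ths i - ths j)^-1.

(* Descending induction on [j]: modulo [Q] the words with [j = m] form a band
   matrix of half-width [m - c] whose columns annihilate degree [< m - i] and
   whose rows annihilate degree [< m - k]. *)
Lemma submod_reduce (Q : R -> Prop) (i k : nat) :
  (i <= d)%N -> (k <= d)%N -> submodP S Q ->
  (forall r j s, (r <= d)%N -> (j <= d)%N -> (s <= d)%N -> (j.*2 <= i + k)%N ->
     Q (es i * e r * es j * e s * es k)) ->
  forall r j s, (r <= d)%N -> (j <= d)%N -> (s <= d)%N ->
     Q (es i * e r * es j * e s * es k).
Proof.
move=> id kd Qmod Qlow.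
(* [c] is the least [j] with [2 j > i + k]. This gives [2 (m - c) < (m - i) + (m - k)], the
   inequality that [submod_band] asks for. *)
pose c := uphalf (i + k).+1.
have ck : ((i + k).+1 <= c.*2)%N by rewrite /c; lia.
have Qlow' r j s : (r <= d)%N -> (j < c)%N -> (j <= d)%N -> (s <= d)%N ->
    Q (es i * e r * es j * e s * es k).
  by move=> rd jc jd sd; apply: Qlow => //; move: jc; rewrite /c; lia.
have step m : (c <= m)%N -> (m <= d)%N ->
    (forall r j s, (r <= d)%N -> (m < j)%N -> (j <= d)%N -> (s <= d)%N ->
       Q (es i * e r * es j * e s * es k)) ->
    forall r s, (r <= d)%N -> (s <= d)%N -> Q (es i * e r * es m * e s * es k).
  move=> cm md Qhigh.
  pose B r s := es i * e r * es m * e s * es k.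
  apply: (@submod_band L R S Ssub Q Qmod d th Sth Sth_inv (m - c) (m - i) (m - k) B); first lia.
  (* Outside the band, the relation with [p] isolates [j = m]: the roots remove [c <= j < m], the
     hypothesis covers [j < c], and the induction covers [j > m]. *)
  - move=> r s rd sd rs; pose p := roots_poly ths (iota c (m - c)).
    have pd : all (fun l => l <= d)%N (iota c (m - c)).
      by apply/allP => l; rewrite mem_iota; lia.
    have mp : m \notin iota c (m - c) by rewrite mem_iota; lia.
    have [c0 Sc] := roots_poly_unit Ssub Sths_inv pd md mp.
    apply: (submod_unit Qmod Sc c0).
    have /(congr1 (fun x => es i * x * es k)) : \sum_(l < d.+1) p.[ths l] *: (e r * es l * e s) = 0.
      by apply: e_van => //; rewrite size_roots_poly size_iota; lia.
    rewrite mulr0 mul0r mulr_sumr mulr_suml (bigD1 (inord m)) //= inordK //.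
    rewrite -scalerAr -scalerAl !mulrA -/(B r s) => /eqP; rewrite addr_eq0 => /eqP ->.
    apply: (submodN Ssub Qmod); apply: (submod_sum Qmod) => l lm.
    have ld := ltn_ord l.
    have {}lm : (l : nat) != m.
      by apply: contraNneq lm => E1; rewrite -val_eqE /= inordK // E1.
    rewrite -scalerAr -scalerAl !mulrA.
    case: (boolP ((l : nat) \in iota c (m - c))) => lc.
      by rewrite roots_poly_root // scale0r; case: Qmod.
    case: Qmod => _ _; apply; first exact: (roots_poly_scalar Ssub Sths).
    have [lc'|lc'] := ltnP l c; first by apply: Qlow'; lia.
    by apply: Qhigh; move: lc lm; rewrite ?mem_iota; lia.
  - move=> s p sd sp; rewrite /B.
    under eq_bigr do rewrite -[_ * es k]mulrA scalerAl.
    by rewrite -mulr_suml es_van ?mul0r //; lia.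
  - move=> r p rd sp; rewrite /B.
    under eq_bigr do rewrite -mulrA -mulrA (mulrA (es m)) scalerAr.
    by rewrite -mulr_sumr es_van ?mulr0 //; lia.
have Qall n r m s : (d - m <= n)%N -> (r <= d)%N -> (m <= d)%N -> (s <= d)%N ->
    Q (es i * e r * es m * e s * es k).
  elim: n r m s => [|n IH] r m s dm rd md sd.
    have [mc|mc] := ltnP m c; first exact: Qlow'.
    by apply: step => // r' j s' _ mj jd; lia.
  have [mc|mc] := ltnP m c; first exact: Qlow'.
  by apply: step => // r' j s' rd' mj jd sd'; apply: IH; lia.
by move=> r j s; apply: (Qall (d - j)%N).
Qed.

Definition word (ws : seq (nat * nat)) : R := es 0%N * \prod_(p <- ws) (e p.1 * es p.2).

Definition small_word (ws : seq (nat * nat)) := all (fun p => (p.1 <= d) && (p.2 <= d))%N ws.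

Definition corner_word x := exists rs : seq nat,
  all (fun r => r <= d)%N rs /\ x = es 0%N * \prod_(r <- rs) (e r * es 0%N).

Definition last_es (ws : seq (nat * nat)) := last 0%N [seq p.2 | p <- ws].

Lemma word_rcons ws p : word (rcons ws p) = word ws * (e p.1 * es p.2).
Proof. by rewrite /word -cats1 big_cat big_seq1 /= mulrA. Qed.

Lemma word_last ws : small_word ws -> (last_es ws <= d)%N /\ word ws * es (last_es ws) = word ws.
Proof.
elim/last_ind: ws => [|ws p _].
  by rewrite /last_es /= /word big_nil mulr1 es_idem.
rewrite /small_word all_rcons => /andP[/andP[pd pd2] _].
rewrite /last_es map_rcons last_rcons; split=> //.
by rewrite word_rcons -!mulrA es_idem.
Qed.

(* A sequence starting and ending at 0 which is not identically 0 fails to be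
   convex at the first occurrence of its maximum. *)
Lemma nonconvex_split ws : last_es ws = 0%N -> has (fun p => p.2 != 0%N) ws ->
  exists s1 rm sk s2, ws = s1 ++ rm :: sk :: s2 /\ (last_es s1 + sk.2 < rm.2.*2)%N.
Proof.
move=> l0 hn0; pose M := (\max_(p <- ws) p.2)%N.
have leM p : p \in ws -> (p.2 <= M)%N by move=> pw; rewrite /M; apply: leq_bigmax_seq.
have M0 : (0 < M)%N.
  by case/hasP: hn0 => p pw p0; apply: leq_trans (leM _ pw); rewrite lt0n.
have hM : has (fun p => p.2 == M) ws.
  apply/hasP; rewrite /M; elim: (ws) hn0 => // p s IH /= ps.
  rewrite big_cons; have [Ms|Ms] := leqP (\max_(j <- s) j.2) p.2.
    by exists p; rewrite ?mem_head //; apply/eqP; lia.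
  have hs : has (fun p => p.2 != 0%N) s.
    apply: contraTT Ms => /hasPn s0; rewrite -leqNgt big_seq big1 // => j js.
    by apply/eqP; have := s0 j js; rewrite negbK.
  by have [j js jM] := IH hs; exists j; [rewrite inE js orbT | rewrite (eqP jM); apply/eqP; lia].
clearbody M; case: (split_find hM) l0 leM => rm s1 s2 /eqP rmM s1M l0 leM.
case: s2 l0 leM => [|sk s2] l0 leM.
  by move: l0 rmM M0; rewrite /last_es cats0 map_rcons last_rcons => -> <-.
exists s1, rm, sk, s2; split; first by rewrite cat_rcons.
have skM : (sk.2 <= M)%N by apply: leM; rewrite mem_cat mem_head orbT.
suff l1M : (last_es s1 < M)%N by rewrite rmM -addnn -addSn leq_add.
case/lastP: s1 s1M leM {l0} => [|s1 p]; first by rewrite /last_es /=.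
rewrite has_rcons negb_or => /andP[pM _] leM; rewrite /last_es map_rcons last_rcons ltn_neqAle pM.
by apply: leM; rewrite mem_cat mem_rcons !inE -cats1 mem_cat inE eqxx !orbT.
Qed.

(** At a non-convex triple [l, m, k] the middle index is replaced by indices [j] with
    [2 j <= l + k < 2 m], so the sum [wt] of all indices drops and the rewriting ends at words whose
    indices are all 0. *)
Lemma closed_word_corner ws : small_word ws -> last_es ws = 0%N ->
  span S corner_word (word ws).
Proof.
pose wt (s : seq (nat * nat)) := (\sum_(p <- s) p.2)%N.
have flat s : small_word s -> (forall p, p \in s -> p.2 = 0%N) -> span S corner_word (word s).
  move=> sw s0; rewrite -[word s]scale1r; apply: span_gen; first by case: Ssub.
  exists (map fst s); split; first by apply/allP => r /mapP[p /(allP sw) /andP[pd _] ->].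
  rewrite /word big_map; congr (_ * _); rewrite big_seq [RHS]big_seq.
  by apply: eq_bigr => p /s0 ->.
move: {2}(wt ws) (leqnn (wt ws)) => n; elim: n ws => [|n IH] ws wn sw lw.
  by apply: flat => // p pw; move: wn; rewrite /wt (big_rem p pw) /=; lia.
have [hn0|/hasPn h0] := boolP (has (fun p => p.2 != 0%N) ws); last first.
  by apply: flat => // p /h0; rewrite negbK => /eqP.
have [s1 [rm [sk [s2 [E conv]]]]] := nonconvex_split lw hn0.
case: rm sk E conv => [r m] [s k] /= E conv.
have [] : [/\ small_word s1, (r <= d)%N /\ (m <= d)%N, (s <= d)%N /\ (k <= d)%N & small_word s2].
  move: sw; rewrite E /small_word all_cat /=.
  by case/andP=> -> /andP[/andP[-> ->] /andP[/andP[-> ->] ->]].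
move=> sw1 [rd md] [sd kd] sw2.
have [l1d l1E] := word_last sw1.
pose Q x := span S corner_word (word s1 * x * \prod_(p <- s2) (e p.1 * es p.2)).
have Qw r' j s' : Q (es (last_es s1) * e r' * es j * e s' * es k) =
    span S corner_word (word (s1 ++ (r', j) :: (s', k) :: s2)).
  by congr (span _ _ _); rewrite !mulrA l1E /word big_cat !big_cons /= !mulrA.
rewrite E -Qw; apply: submod_reduce => //.
  case: (submod_span Ssub corner_word) => C0 CD CZ; split; rewrite /Q.
  - by rewrite mulr0 mul0r.
  - by move=> x y Qx Qy; rewrite mulrDr mulrDl; apply: CD.
  - by move=> c x Sc Qx; rewrite -scalerAr -scalerAl; apply: CZ.
move=> r' j s' rd' jd sd' jl; rewrite Qw; apply: IH.
- by move: wn; rewrite E /wt !big_cat !big_cons /=; lia.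
- by rewrite /small_word all_cat /= rd' jd sd' kd -/(small_word s1) sw1.
- by move: lw; rewrite E /last_es !map_cat !last_cat.
Qed.

Definition small_words x := exists ws, small_word ws /\ x = word ws.

Lemma words_mul_e x i : (i <= d)%N -> span S small_words x -> span S small_words (x * e i).
Proof.
move=> id; case: (submod_span Ssub small_words) => C0 CD CZ.
apply: (@span_ind_mod _ _ S small_words (fun z => span S small_words (z * e i))); rewrite ?mul0r //.
  by move=> y z; rewrite mulrDl; apply: CD.
move=> c _ Sc [ws [sw ->]]; rewrite -scalerAl; apply: CZ => //.
rewrite -[_ * _]mulr1 -sum_es mulr_sumr; apply: (submod_sum (submod_span Ssub _)) => j _.
rewrite -mulrA -(word_rcons ws (i, j : nat)) -[word _]scale1r; apply: span_gen.
  by case: Ssub.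
by exists (rcons ws (i, j : nat)); rewrite /small_word all_rcons /= id -ltnS ltn_ord.
Qed.

Lemma words_mul_es x i : (i <= d)%N -> span S small_words x -> span S small_words (x * es i).
Proof.
move=> id; case: (submod_span Ssub small_words) => C0 CD CZ.
apply: (@span_ind_mod _ _ S small_words (fun z => span S small_words (z * es i))); rewrite ?mul0r //.
  by move=> y z; rewrite mulrDl; apply: CD.
move=> c _ Sc [ws [sw ->]]; rewrite -scalerAl; apply: CZ => //.
have [ld <-] := word_last sw; rewrite -mulrA es_orth //; case: eqP => [_|_]; last by rewrite mulr0.
rewrite (word_last sw).2 -[word _]scale1r; apply: span_gen; first by case: Ssub.
by exists ws.
Qed.

Lemma words_mul_sum x (c : nat -> L) (f : nat -> R) :
  (forall i, (i <= d)%N -> S (c i)) ->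
  (forall i, (i <= d)%N -> span S small_words (x * f i)) ->
  span S small_words (x * \sum_(i < d.+1) c i *: f i).
Proof.
move=> Sc Sx; rewrite mulr_sumr; apply: (submod_sum (submod_span Ssub _)) => i _.
rewrite -scalerAr; case: (submod_span Ssub small_words) => _ _; apply.
  by apply: Sc; rewrite -ltnS.
by apply: Sx; rewrite -ltnS.
Qed.

Lemma words_corner x : span S small_words x -> span S corner_word (x * es 0%N).
Proof.
case: (submod_span Ssub corner_word) => C0 CD CZ.
apply: (@span_ind_mod _ _ S small_words (fun z => span S corner_word (z * es 0%N))); rewrite ?mul0r //.
  by move=> y z; rewrite mulrDl; apply: CD.
move=> c _ Sc [ws [sw ->]]; rewrite -scalerAl; apply: CZ => //.
have [ld E] := word_last sw; rewrite -E -mulrA es_orth //; case: eqP => [l0|_]; last by rewrite mulr0.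
by rewrite E; apply: closed_word_corner.
Qed.

End Scalars.
End Words.

(** * Commutativity of the corner and its monomials *)

Lemma prod_comm_mulr (R : nzRingType) (n : nat) (h : 'I_n -> R) (m : 'X_{1..n}) (i : 'I_n) :
  (forall j k, GRing.comm (h j) (h k)) ->
  (\prod_(j < n) h j ^+ m j) * h i = \prod_(j < n) h j ^+ (m + U_(i))%MM j.
Proof.
move=> hC; have := mem_index_enum i; have := index_enum_uniq 'I_n.
elim: (index_enum _) => //= k s IH /andP[ks us]; rewrite inE !big_cons.
case: (eqVneq i k) => [->|ik] /= iS.
  have -> : \prod_(j <- s) h j ^+ (m + U_(k))%MM j = \prod_(j <- s) h j ^+ m j.
    rewrite big_seq [RHS]big_seq; apply: eq_bigr => j js.
    rewrite mnmDE mnm1E; case: eqP => [E|_]; last by rewrite addn0.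
    by rewrite E js in ks.
  rewrite mnmDE mnm1E eqxx addn1 exprSr -!mulrA; congr (_ * _); apply/commr_sym.
  by apply: commr_prod => j _; apply: commrX.
by rewrite -mulrA IH // mnmDE mnm1E (negbTE ik) addn0.
Qed.

Section Corner.
Variables (L : fieldType) (R : algType L) (d : nat).
Variables (th ths : nat -> L) (e es : nat -> R).
Hypothesis e_orth : orthogonal_idempotents d e.
Hypothesis es_orth : orthogonal_idempotents d es.
Hypothesis sum_e : \sum_(i < d.+1) e i = 1.
Hypothesis sum_es : \sum_(i < d.+1) es i = 1.
Hypothesis e_van : poly_vanish d ths e es.
Hypothesis es_van : poly_vanish d th es e.
Hypothesis th_inj : forall i j, (i <= d)%N -> (j <= d)%N -> i != j -> th i != th j.
Hypothesis ths_inj : forall i j, (i <= d)%N -> (j <= d)%N -> i != j -> ths i != ths j.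

Let ff : subringP (fun _ : L => True). Proof. by []. Qed.

Lemma corner_comm r s : (r <= d)%N -> (s <= d)%N ->
  es 0%N * e r * es 0%N * e s * es 0%N = es 0%N * e s * es 0%N * e r * es 0%N.
Proof.
(* [D j] is a band matrix of half-width [j] that annihilates degree [< j], and
   its antisymmetry replaces the missing degrees. *)
pose D j r s := es 0%N * e r * es j * e s * es 0%N - es 0%N * e s * es j * e r * es 0%N.
suff D0 j r' s' : (j <= d)%N -> (r' <= d)%N -> (s' <= d)%N -> D j r' s' = 0.
  by move=> rd sd; apply/eqP; rewrite -subr_eq0; apply/eqP; apply: D0.
have Zmod : submodP (fun _ : L => True) (fun x : R => x = 0).
  by split=> // [x y -> ->|c x _ ->]; rewrite ?addr0 ?scaler0.
have inv (t : nat -> L) : (forall i j, (i <= d)%N -> (j <= d)%N -> i != j -> t i != t j) ->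
    forall i j, (i <= d)%N -> (j <= d)%N -> i != j -> t i - t j != 0 /\ True.
  by move=> tinj x y xd yd xy; rewrite subr_eq0; split=> //; apply: tinj.
have anti k x y : D k x y = - D k y x by rewrite /D opprB.
have step k : (k <= d)%N ->
    (forall l x y, (k < l)%N -> (l <= d)%N -> (x <= d)%N -> (y <= d)%N -> D l x y = 0) ->
    forall x y, (x <= d)%N -> (y <= d)%N -> D k x y = 0.
  move=> kd IH.
  have band x y : (x <= d)%N -> (y <= d)%N -> (k + x < y)%N || (k + y < x)%N -> D k x y = 0.
    move=> xd yd xy; pose p := roots_poly ths (iota 0 k).
    have pd : all (fun l => l <= d)%N (iota 0 k) by apply/allP => l; rewrite mem_iota; lia.
    have kp : k \notin iota 0 k by rewrite mem_iota; lia.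
    have [c0 _] := roots_poly_unit ff (inv _ ths_inj) pd kd kp.
    apply: (submod_unit Zmod I c0).
    have sp : (size p + x <= y)%N || (size p + y <= x)%N by rewrite size_roots_poly size_iota; lia.
    have sp' := sp; rewrite orbC in sp'.
    have E1 := congr1 (fun u => es 0%N * u * es 0%N) (e_van xd yd sp).
    have E2 := congr1 (fun u => es 0%N * u * es 0%N) (e_van yd xd sp').
    have : \sum_(l < d.+1) p.[ths l] *: D l x y = 0.
      have := congr2 (fun u v => u - v) E1 E2.
      rewrite /= !mulr0 !mul0r subr0 !mulr_sumr !mulr_suml -sumrB => E.
      rewrite -[RHS]E; apply: eq_bigr => l _.
      by rewrite -!scalerAr -!scalerAl -scalerBr !mulrA.
    rewrite (bigD1 (inord k)) //= inordK // big1 ?addr0 // => l lk.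
    have ld := ltn_ord l.
    have {}lk : (l : nat) != k.
      by apply: contraNneq lk => E; rewrite -val_eqE /= inordK // E.
    have [lk'|lk'] := ltnP l k; first by rewrite roots_poly_root ?scale0r // mem_iota; lia.
    by rewrite IH ?scaler0 //; lia.
  (* In column [y], the entries above the diagonal vanish by antisymmetry and induction on [y], the
     diagonal one by antisymmetry, and those below row [y + k] by [band]. The [k] rows between are
     settled by the [k] moments. *)
  move=> x y xd; elim/ltn_ind: y x xd => y IHy x xd yd.
  have [xy|xy] := ltnP x y; first by rewrite anti IHy ?oppr0.
  apply: (@submod_lagrange L R _ ff _ Zmod d th (fun _ _ => I) (inv _ th_inj)
    y.+1 k (fun r => D k r y)) => //.
    move=> p sp; rewrite /D.
    under eq_bigr do rewrite scalerBr.
    rewrite sumrB.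
    under eq_bigr do rewrite -[_ * es 0%N]mulrA scalerAl.
    rewrite -mulr_suml es_van //; last by lia.
    under eq_bigr do rewrite -!mulrA (mulrA (es k)) mulrA scalerAr.
    rewrite -mulr_sumr es_van //; last by lia.
    by rewrite mul0r mulr0 subr0.
  move=> z zd /orP[zy|]; last by move=> yz; apply: band => //; lia.
  have [->|zy'] := eqVneq z y; first by rewrite /D subrr.
  by rewrite anti IHy ?oppr0 //; lia.
have all k : forall j x y, (d - j <= k)%N -> (j <= d)%N -> (x <= d)%N -> (y <= d)%N -> D j x y = 0.
  elim: k => [|k IH] j' x y dj jd xd yd; apply: step => // l x' y' jl ld x'd y'd.
    by lia.
  by apply: IH => //; lia.
by apply: (all (d - j)%N).
Qed.

Variable a : R.
Hypothesis aE : a = \sum_(i < d.+1) th i *: e i.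

Definition corner (i : nat) : R := es 0%N * tau th i a * es 0%N.
Definition mon (m : 'X_{1..d}) : R := es 0%N * \prod_(j < d) corner j.+1 ^+ m j.

Lemma tauE i : tau th i a = \sum_(l < d.+1) (roots_poly th (iota 0 i)).[th l] *: e l.
Proof.
rewrite /tau; elim: i => [|i IH].
  by rewrite big_ord0 -sum_e; apply: eq_bigr => l _; rewrite /roots_poly big_nil hornerC scale1r.
have -> : iota 0 i.+1 = iota 0 i ++ [:: i] by rewrite -[i.+1]addn1 iotaD.
rewrite big_ord_recr /= IH mulr_suml; apply: eq_bigr => l _ /=.
rewrite /roots_poly big_cat big_seq1 /= hornerM hornerXsubC.
rewrite -scalerAl -scalerA; congr (_ *: _).
rewrite mulrBr -scalerAr mulr1 scalerBl; congr (_ - _).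
rewrite aE mulr_sumr (bigD1 l) //= -scalerAr e_orth -1?ltnS // eqxx big1 ?addr0 //.
move=> k kl; rewrite -scalerAr e_orth -1?ltnS // ifN ?scaler0 //.
by rewrite eq_sym.
Qed.

Let es0 : es 0%N * es 0%N = es 0%N. Proof. by rewrite es_orth. Qed.

Lemma corner_comm_tau i j : GRing.comm (corner i) (corner j).
Proof.
rewrite /GRing.comm /corner !tauE !mulr_sumr !mulr_suml.
under eq_bigr do rewrite mulr_sumr.
rewrite exchange_big; apply: eq_bigr => l _; rewrite mulr_sumr; apply: eq_bigr => k _.
rewrite -!(scalerAr, scalerAl) !scalerA mulrC; congr (_ *: _).
rewrite !mulrA -!(mulrA _ (es 0%N) (es 0%N)) !es0.
by apply: corner_comm; rewrite -ltnS.
Qed.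

Lemma corner_absorb i : es 0%N * corner i = corner i /\ corner i * es 0%N = corner i.
Proof. by split; rewrite /corner -?mulrA ?es0 // !mulrA es0. Qed.

Lemma mon_es0 m : mon m * es 0%N = mon m.
Proof.
have : GRing.comm (es 0%N) (\prod_(j < d) corner j.+1 ^+ m j).
  apply: commr_prod => j _; apply: commrX.
  by rewrite /GRing.comm !(corner_absorb _).1 (corner_absorb _).2.
by rewrite /mon -mulrA => <-; rewrite mulrA es0.
Qed.

Lemma mon_mul m (i : 'I_d) : mon m * corner i.+1 = mon (m + U_(i))%MM.
Proof.
rewrite /mon -mulrA (@prod_comm_mulr R d (fun j : 'I_d => corner j.+1)) // => j k.
exact: corner_comm_tau.
Qed.

Lemma mon0 : mon 0%MM = es 0%N.
Proof. by rewrite /mon big1 ?mulr1 // => j _; rewrite mnm0E expr0. Qed.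

Section Scalars.
Variable S : L -> Prop.
Hypothesis Ssub : subringP S.
Hypothesis Sth : forall i, (i <= d)%N -> S (th i).
Hypothesis Sth_inv : forall i j, (i <= d)%N -> (j <= d)%N -> i != j ->
  th i - th j != 0 /\ S (th i - th j)^-1.

Definition is_mon x := exists m, x = mon m.

(** [tau k] vanishes at [th l] for [l < k] and is a unit at [th k], so the passage from the
    idempotents to the corners is triangular with units on the diagonal; it is inverted downwards
    from [r = d]. *)
Lemma corner_idem r : (r <= d)%N ->
  span S (fun x => exists2 i, (i <= d)%N & x = corner i) (es 0%N * e r * es 0%N).
Proof.
set G := fun x => _; have Smod := submod_span Ssub G.
have step k : (k <= d)%N ->
    (forall l, (k < l)%N -> (l <= d)%N -> span S G (es 0%N * e l * es 0%N)) ->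
    span S G (es 0%N * e k * es 0%N).
  move=> kd IH.
  have qd : all (fun l => l <= d)%N (iota 0 k) by apply/allP => l; rewrite mem_iota; lia.
  have kq : k \notin iota 0 k by rewrite mem_iota; lia.
  have [c0 Sc] := roots_poly_unit Ssub Sth_inv qd kd kq.
  apply: (submod_unit Smod Sc c0).
  have Sk : span S G (corner k).
    by rewrite -[corner k]scale1r; apply: span_gen; [case: Ssub | exists k].
  move: Sk; rewrite /corner tauE mulr_sumr mulr_suml (bigD1 (inord k)) //= inordK //.
  rewrite -scalerAr -scalerAl; set x := _ *: _; set y := \sum_(i < _ | _) _ => Sxy.
  rewrite -[x](addrK y); case: (Smod) => _ SD SZ; apply: SD => //.
  apply: (submodN Ssub Smod); apply: (submod_sum Smod) => l lk; have ld := ltn_ord l.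
  have {}lk : (l : nat) != k.
    by apply: contraNneq lk => E1; rewrite -val_eqE /= inordK // E1.
  rewrite -scalerAr -scalerAl.
  have [lk'|lk'] := ltnP l k.
    by rewrite roots_poly_root ?scale0r ?mem_iota //; case: Smod.
  by apply: SZ; [apply: (roots_poly_scalar Ssub Sth) | apply: IH; lia].
move: {2}(d - r)%N (leqnn (d - r)%N) => n.
elim: n r => [|n IH] r dr rd; apply: step => // l rl ld; first lia.
by apply: IH; lia.
Qed.

Lemma span_mon_mul x i : (i <= d)%N -> span S is_mon x -> span S is_mon (x * corner i).
Proof.
move=> id; case: (submod_span Ssub is_mon) => C0 CD CZ.
apply: (@span_ind_mod _ _ S is_mon (fun z => span S is_mon (z * corner i))); rewrite ?mul0r //.
  by move=> u v; rewrite mulrDl; apply: CD.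
move=> c _ Sc [m ->]; rewrite -scalerAl; apply: CZ => //.
rewrite -[_ * _]scale1r; apply: span_gen; first by case: Ssub.
case: i id => [|i] id; last by exists (m + U_(Ordinal id))%MM; rewrite -mon_mul.
by exists m; rewrite /corner /tau big_ord0 mulr1 es0 mon_es0.
Qed.

Lemma corner_word_mon x : corner_word d e es x -> span S is_mon x.
Proof.
case=> rs [rd ->]; elim/last_ind: rs rd => [|rs r IH].
  rewrite big_nil mulr1 -mon0 -[mon _]scale1r => _; apply: span_gen; first by case: Ssub.
  by exists 0%MM.
rewrite all_rcons => /andP[rd /IH]; rewrite -cats1 big_cat big_seq1 /= mulrA.
set y := _ * \prod_(_ <- _) _ => Sy.
have -> : y * (e r * es 0%N) = y * (es 0%N * e r * es 0%N).
  have ye : y * es 0%N = y.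
    apply: (@span_ind_mod _ _ S is_mon (fun z => z * es 0%N = z)) Sy; rewrite ?mul0r //.
      by move=> u v Eu Ev; rewrite mulrDl Eu Ev.
    by move=> c _ _ [m ->]; rewrite -scalerAl mon_es0.
  by rewrite !mulrA ye.
case: (submod_span Ssub is_mon) => C0 CD CZ.
have := corner_idem rd.
apply: (@span_ind_mod _ _ S _ (fun z => span S is_mon (y * z))); rewrite ?mulr0 //.
  by move=> u v; rewrite mulrDr; apply: CD.
move=> c _ Sc [i id ->]; rewrite -scalerAr; apply: CZ => //.
exact: span_mon_mul.
Qed.

End Scalars.
End Corner.

(** * Quotient of a ring of integral elements *)

(** Classical truth value of [P]: the canonical representatives below come from [choose], which
    takes boolean predicates. *)
Definition asb (P : Prop) : bool := if excluded_middle_informative P then true else false.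

Lemma asbP P : reflect P (asb P).
Proof. by rewrite /asb; case: excluded_middle_informative => ?; constructor. Qed.

Section Quotient.
Variables (F L : fieldType) (iota : {rmorphism F -> L}) (R : algType L).
Variables (A I : R -> Prop).
Hypothesis A1 : A 1.
Hypothesis AB : forall x y, A x -> A y -> A (x - y).
Hypothesis AM : forall x y, A x -> A y -> A (x * y).
Hypothesis AZ : forall c x, A x -> A (iota c *: x).
Hypothesis IA : forall x, I x -> A x.
Hypothesis I0 : I 0.
Hypothesis IB : forall x y, I x -> I y -> I (x - y).
Hypothesis IMl : forall x y, A x -> I y -> I (x * y).
Hypothesis IMr : forall x y, I x -> A y -> I (x * y).
Hypothesis I1 : ~ I 1.

Let IN x : I x -> I (- x). Proof. by move=> Ix; rewrite -sub0r; apply: IB. Qed.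
Let ID x y : I x -> I y -> I (x + y).
Proof. by move=> Ix Iy; rewrite -[y]opprK; apply: IB => //; apply: IN. Qed.
Let A0 : A 0. Proof. exact: IA. Qed.
Let AN x : A x -> A (- x). Proof. by move=> Ax; rewrite -sub0r; apply: AB. Qed.
Let AD x y : A x -> A y -> A (x + y).
Proof. by move=> Ax Ay; rewrite -[y]opprK; apply: AB => //; apply: AN. Qed.
Let IZ c x : I x -> I (iota c *: x).
Proof. by move=> Ix; rewrite -[x]mul1r scalerAl; apply: IMl => //; apply: AZ. Qed.

(* Canonical representative of the class of [x] modulo [I]; elements outside [A]
   get the representative of [0]. *)
Definition quot_repr (x : R) : R :=
  let x' := if asb (A x) then x else 0 in
  choose (fun y => asb (A y /\ I (y - x'))) x'.

Let repr_in x : A x -> A (quot_repr x) /\ I (quot_repr x - x).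
Proof.
move=> Ax; rewrite /quot_repr; case: asbP => // _; apply/asbP.
by apply: (@chooseP R (fun y => asb (A y /\ I (y - x)))); apply/asbP; rewrite subrr.
Qed.

Let repr_eq x y : A x -> A y -> I (x - y) -> quot_repr x = quot_repr y.
Proof.
move=> Ax Ay Ixy; rewrite /quot_repr; do 2![case: asbP => // _].
have -> : choose (fun z => asb (A z /\ I (z - x))) x = choose (fun z => asb (A z /\ I (z - y))) x.
  apply: eq_choose => z; apply/asbP/asbP => [] [Az Iz]; split=> //.
    by rewrite -(subrK x z) -addrA; apply: ID.
  by rewrite -(subrK y z) -addrA; apply: ID => //; rewrite -opprB; apply: IN.
by apply: choose_id; apply/asbP; rewrite ?subrr.
Qed.

Let repr_A x : A (quot_repr x).
Proof.
have [/repr_in[]//|nAx] := excluded_middle_informative (A x).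
have -> : quot_repr x = quot_repr 0.
  by rewrite /quot_repr; case: asbP => // _; case: asbP.
by have [] := repr_in A0.
Qed.

Let repr_id x : quot_repr (quot_repr x) = quot_repr x.
Proof.
have [Ax|nAx] := excluded_middle_informative (A x).
  by apply: repr_eq => //; apply: (repr_in Ax).2.
have -> : quot_repr x = quot_repr 0.
  by rewrite /quot_repr; case: asbP => // _; case: asbP.
by apply: repr_eq => //; apply: (repr_in A0).2.
Qed.

Definition quot := {x : R | quot_repr x == x}.
HB.instance Definition _ := Choice.on quot.

Definition quot_pi (x : R) : quot := exist _ (quot_repr x) (introT eqP (repr_id x)).

Let pi_val (u : quot) : quot_pi (val u) = u.
Proof. by apply: val_inj; apply/eqP; apply: (valP u). Qed.

Let val_A (u : quot) : A (val u).
Proof. rewrite -(eqP (valP u)); exact: repr_A. Qed.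

Let pi_eq x y : A x -> A y -> I (x - y) -> quot_pi x = quot_pi y.
Proof. by move=> Ax Ay Ixy; apply: val_inj; apply: repr_eq. Qed.

Let valpi x : A x -> I (val (quot_pi x) - x).
Proof. by move=> /repr_in[]. Qed.

Definition qadd (u v : quot) := quot_pi (val u + val v).
Definition qopp (u : quot) := quot_pi (- val u).
Definition qmul (u v : quot) := quot_pi (val u * val v).
Definition qscale c (u : quot) := quot_pi (iota c *: val u).

Let pi_add x y : A x -> A y -> quot_pi (x + y) = qadd (quot_pi x) (quot_pi y).
Proof.
move=> Ax Ay; apply: esym; apply: pi_eq; [exact: AD | exact: AD |].
by rewrite opprD addrACA; apply: ID; apply: valpi.
Qed.

Let pi_opp x : A x -> quot_pi (- x) = qopp (quot_pi x).
Proof.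
move=> Ax; apply: esym; apply: pi_eq; [exact: AN | exact: AN |].
by rewrite -opprD; apply: IN; apply: valpi.
Qed.

Let pi_mul x y : A x -> A y -> quot_pi (x * y) = qmul (quot_pi x) (quot_pi y).
Proof.
move=> Ax Ay; apply: esym; apply: pi_eq; [exact: AM | exact: AM |].
rewrite -(subrK (x * val (quot_pi y)) (_ * _)) -addrA -mulrBl -mulrBr.
by apply: ID; [apply: IMr | apply: IMl]; rewrite //; apply: valpi.
Qed.

Let pi_scale c x : A x -> quot_pi (iota c *: x) = qscale c (quot_pi x).
Proof.
move=> Ax; apply: esym; apply: pi_eq; [exact: AZ | exact: AZ |].
by rewrite -scalerBr; apply: IZ; apply: valpi.
Qed.

Let quot_ind (P : quot -> Prop) : (forall x, A x -> P (quot_pi x)) -> forall u, P u.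
Proof. by move=> PA u; rewrite -(pi_val u); apply: PA. Qed.

Let qaddA : associative qadd.
Proof.
elim/quot_ind=> x Ax; elim/quot_ind=> y Ay; elim/quot_ind=> z Az.
by rewrite -!pi_add ?addrA //; apply: AD.
Qed.

Let qaddC : commutative qadd.
Proof. by move=> u v; rewrite /qadd addrC. Qed.

Let qadd0 : left_id (quot_pi 0) qadd.
Proof. by elim/quot_ind=> x Ax; rewrite -pi_add ?add0r. Qed.

Let qaddN : left_inverse (quot_pi 0) qopp qadd.
Proof. by elim/quot_ind=> x Ax; rewrite -pi_opp // -pi_add ?addNr //; apply: AN. Qed.

HB.instance Definition _ := GRing.isZmodule.Build quot qaddA qaddC qadd0 qaddN.

Let qmulA : associative qmul.
Proof.
elim/quot_ind=> x Ax; elim/quot_ind=> y Ay; elim/quot_ind=> z Az.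
by rewrite -!pi_mul ?mulrA //; apply: AM.
Qed.

Let qmul1 : left_id (quot_pi 1) qmul.
Proof. by elim/quot_ind=> x Ax; rewrite -pi_mul ?mul1r. Qed.

Let qmulr1 : right_id (quot_pi 1) qmul.
Proof. by elim/quot_ind=> x Ax; rewrite -pi_mul ?mulr1. Qed.

Let qmulDl : left_distributive qmul qadd.
Proof.
elim/quot_ind=> x Ax; elim/quot_ind=> y Ay; elim/quot_ind=> z Az.
by rewrite -pi_add // -!pi_mul ?mulrDl ?pi_add //; auto.
Qed.

Let qmulDr : right_distributive qmul qadd.
Proof.
elim/quot_ind=> x Ax; elim/quot_ind=> y Ay; elim/quot_ind=> z Az.
by rewrite -pi_add // -!pi_mul ?mulrDr ?pi_add //; auto.
Qed.

Let pi_eq0 x : A x -> quot_pi x = quot_pi 0 -> I x.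
Proof.
move=> Ax /(congr1 val) /= E; rewrite -(subrK (quot_repr x) x).
apply: ID; first by rewrite -opprB; apply: IN; have [] := repr_in Ax.
by rewrite E -[quot_repr 0]subr0; have [] := repr_in A0.
Qed.

Let qone0 : quot_pi 1 != quot_pi 0.
Proof. by apply/eqP => /(pi_eq0 A1). Qed.

HB.instance Definition _ := GRing.Zmodule_isNzRing.Build quot qmulA qmul1 qmulr1 qmulDl qmulDr qone0.

Let qscaleA a b u : qscale a (qscale b u) = qscale (a * b) u.
Proof. by elim/quot_ind: u => x Ax; rewrite -!pi_scale ?scalerA -?rmorphM //; apply: AZ. Qed.

Let qscale1 : left_id 1 qscale.
Proof. by elim/quot_ind=> x Ax; rewrite -pi_scale // rmorph1 scale1r. Qed.

Let qscaleDr : right_distributive qscale +%R.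
Proof.
move=> c; elim/quot_ind=> x Ax; elim/quot_ind=> y Ay; rewrite -[_ + _]pi_add //.
rewrite -pi_scale ?scalerDr; last exact: AD.
by rewrite -!pi_scale // pi_add //; apply: AZ.
Qed.

Let qscaleDl u : {morph qscale^~ u : a b / a + b}.
Proof.
elim/quot_ind: u => x Ax a b; by rewrite -!pi_scale // rmorphD scalerDl; apply: pi_add; apply: AZ.
Qed.

HB.instance Definition _ := GRing.Zmodule_isLmodule.Build F quot qscaleA qscale1 qscaleDr qscaleDl.

Let qscaleAl (c : F) (u v : quot) : c *: (u * v) = (c *: u) * v.
Proof.
elim/quot_ind: u => x Ax; elim/quot_ind: v => y Ay.
rewrite -[quot_pi x * _]pi_mul // -[LHS]pi_scale; last exact: AM.
by rewrite -[_ *: quot_pi x]pi_scale // -[RHS]pi_mul ?scalerAl //; apply: AZ.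
Qed.

HB.instance Definition _ := GRing.Lmodule_isLalgebra.Build F quot qscaleAl.

Let qscaleAr (c : F) (u v : quot) : c *: (u * v) = u * (c *: v).
Proof.
elim/quot_ind: u => x Ax; elim/quot_ind: v => y Ay.
rewrite -[quot_pi x * _]pi_mul // -[LHS]pi_scale; last exact: AM.
by rewrite -[_ *: quot_pi y]pi_scale // -[RHS]pi_mul ?scalerAr //; apply: AZ.
Qed.

HB.instance Definition _ := GRing.Lalgebra_isAlgebra.Build F quot qscaleAr.

(** [R] is an algebra over [L], and [A] only over a subring of it; the quotient is one over the
    residue field [F], so the universal property of [T] applies to it. The map [pr] is total, but
    only its values on [A] are meaningful. *)
Lemma quotient_algebra : exists (B : algType F) (pr : R -> B),
  [/\ (forall x y, A x -> A y -> pr (x + y) = pr x + pr y),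
      (forall x y, A x -> A y -> pr (x * y) = pr x * pr y),
      pr 1 = 1,
      (forall c x, A x -> pr (iota c *: x) = c *: pr x) &
      (forall x, A x -> pr x = 0 <-> I x)].
Proof.
exists quot, quot_pi; split; [exact: pi_add | exact: pi_mul | by [] | exact: pi_scale |].
move=> x Ax; split; first exact: pi_eq0.
by move=> Ix; apply: pi_eq; rewrite ?subr0.
Qed.

End Quotient.

(** * The corner map *)

Section Relations.
Variables (L : fieldType) (R : algType L) (d : nat).
Variables (th ths : nat -> L) (a as_ : R) (e es : nat -> R).

Lemma sum_idem_exp (t : nat -> L) (f : nat -> R) (b : R) k :
  orthogonal_idempotents d f -> \sum_(i < d.+1) f i = 1 ->
  b = \sum_(i < d.+1) t i *: f i -> b ^+ k = \sum_(i < d.+1) t i ^+ k *: f i.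
Proof.
move=> fo f1 bE; elim: k => [|k IH].
  by rewrite expr0 -f1; apply: eq_bigr => i _; rewrite expr0 scale1r.
rewrite exprSr IH mulr_suml; apply: eq_bigr => i _.
rewrite bE mulr_sumr (bigD1 i) //= -scalerAl -scalerAr fo -1?ltnS // eqxx scalerA -exprSr.
rewrite big1 ?addr0 // => j ji; rewrite -scalerAl -scalerAr fo -1?ltnS //.
by rewrite ifN ?scaler0 // eq_sym.
Qed.

Lemma sum_idem_poly (t : nat -> L) (f : nat -> R) (b : R) (p : {poly L}) :
  orthogonal_idempotents d f -> \sum_(i < d.+1) f i = 1 ->
  b = \sum_(i < d.+1) t i *: f i ->
  \sum_(i < d.+1) p.[t i] *: f i = \sum_(k < size p) p`_k *: b ^+ k.
Proof.
move=> fo f1 bE.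
under [RHS]eq_bigr do rewrite (sum_idem_exp _ fo f1 bE) scaler_sumr.
rewrite exchange_big; apply: eq_bigr => i _; rewrite horner_coef scaler_suml.
by apply: eq_bigr => k _; rewrite scalerA.
Qed.

Lemma dist_gt (i j k : nat) : (k + i < j)%N || (k + j < i)%N -> (k < `|(i : int) - (j : int)|)%N.
Proof. by move=> H; lia. Qed.

Lemma exp_vanish_poly (t : nat -> L) (f g : nat -> R) (b : R) :
  orthogonal_idempotents d f -> \sum_(i < d.+1) f i = 1 ->
  b = \sum_(i < d.+1) t i *: f i ->
  (forall i j k : 'I_d.+1, (k < `|i - j|)%N -> g i * b ^+ k * g j = 0) ->
  poly_vanish d t g f.
Proof.
move=> fo f1 bE gb r s p rd sd prs.
have -> : \sum_(l < d.+1) p.[t l] *: (g r * f l * g s) = g r * (\sum_(l < d.+1) p.[t l] *: f l) * g s.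
  by rewrite mulr_sumr mulr_suml; apply: eq_bigr => l _; rewrite -scalerAr -scalerAl.
rewrite (sum_idem_poly p fo f1 bE) mulr_sumr mulr_suml big1 // => k _.
have kp := ltn_ord k.
have krs : (k + r < s)%N || (k + s < r)%N by case/orP: prs => prs; apply/orP; [left|right]; lia.
rewrite -scalerAr -scalerAl -[r]/(nat_of_ord (Ordinal (rd : r < d.+1)%N)).
rewrite -[s]/(nat_of_ord (Ordinal (sd : s < d.+1)%N)).
have kd : (k < d.+1)%N by lia.
by rewrite (gb _ _ (Ordinal kd)) ?scaler0 //=; apply: dist_gt.
Qed.

Definition band_rels : Prop :=
  [/\ orthogonal_idempotents d e /\ orthogonal_idempotents d es,
      \sum_(i < d.+1) e i = 1 /\ \sum_(i < d.+1) es i = 1,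
      a = \sum_(i < d.+1) th i *: e i,
      as_ = \sum_(i < d.+1) ths i *: es i &
      poly_vanish d ths e es /\ poly_vanish d th es e].

Lemma LP_rels_band : LP_rels d th ths a e as_ es -> band_rels.
Proof.
case=> eo [eso [e1 [es1 [aE [asE van]]]]].
have ext (f : nat -> R) : (forall i j : 'I_d.+1, f i * f j = if i == j then f i else 0) ->
    orthogonal_idempotents d f.
  move=> fo i j id jd.
  by have := fo (Ordinal (id : i < d.+1)%N) (Ordinal (jd : j < d.+1)%N).
split; [by split; apply: ext | by split | by [] | by [] |].
split.
  by apply: (exp_vanish_poly (ext _ eso) es1 asE) => i j k ijk; case: (van i j k ijk).
by apply: (exp_vanish_poly (ext _ eo) e1 aE) => i j k ijk; case: (van i j k ijk).
Qed.

Variable S : L -> Prop.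
Hypothesis Ssub : subringP S.
Hypothesis Sth : forall i, (i <= d)%N -> S (th i).
Hypothesis Sths : forall i, (i <= d)%N -> S (ths i).
Hypothesis Sth_inv : forall i j, (i <= d)%N -> (j <= d)%N -> i != j ->
  th i - th j != 0 /\ S (th i - th j)^-1.
Hypothesis Sths_inv : forall i j, (i <= d)%N -> (j <= d)%N -> i != j ->
  ths i - ths j != 0 /\ S (ths i - ths j)^-1.
Hypothesis rels : band_rels.

Definition gen_word x := exists w : seq (gen d), x = \prod_(g <- w) gen_val a e as_ es g.

(** The integral form of the spanning argument: the coefficients stay in [S]. It serves twice, over
    the whole field for surjectivity and over the ring of a place for injectivity. *)
Lemma gen_word_corner x : gen_word x ->
  span S (is_mon d th es a) (es 0%N * x * es 0%N).
Proof.
case: rels => -[eo eso] [e1 es1] aE asE [van vans] [w ->].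
have thi i j : (i <= d)%N -> (j <= d)%N -> i != j -> th i != th j.
  by move=> id jd ij; rewrite -subr_eq0; case: (Sth_inv id jd ij).
have thsi i j : (i <= d)%N -> (j <= d)%N -> i != j -> ths i != ths j.
  by move=> id jd ij; rewrite -subr_eq0; case: (Sths_inv id jd ij).
have Sw : span S (small_words d e es) (es 0%N * \prod_(g <- w) gen_val a e as_ es g).
  elim/last_ind: w => [|w g IH].
    rewrite big_nil mulr1 -[es _]scale1r; apply: span_gen; first by case: Ssub.
    by exists [::]; rewrite /word big_nil mulr1.
  rewrite -cats1 big_cat big_seq1 /= mulrA.
  move: IH; set y := es 0%N * _ => IH.
  case: g => [|i||i] /=.
  - rewrite aE; apply: words_mul_sum => // i id; by apply: words_mul_e.
  - by apply: words_mul_e; rewrite // -ltnS.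
  - rewrite asE; apply: words_mul_sum => // i id; by apply: words_mul_es.
  - by apply: words_mul_es; rewrite // -ltnS.
have := words_corner eso van vans Ssub Sth Sths Sth_inv Sths_inv Sw.
have Smod := submod_span Ssub (is_mon d th es a).
apply: (@span_ind_mod _ _ S _ (fun z => span S _ z)); first by constructor.
  by move=> y z; apply: span_add.
move=> c g Sc gw; case: Smod => _ _; apply=> //.
exact: (corner_word_mon eo eso e1 van vans thi thsi aE Ssub Sth Sth_inv gw).
Qed.

End Relations.

Section Mu.
Variables (F : fieldType) (d : nat) (th ths : nat -> F) (T : algType F).
Variables (a : T) (e : nat -> T) (as_ : T) (es : nat -> T).

Lemma muE (p : {mpoly F[d]}) :
  mu th a es p = es 0%N * mmap (in_alg T) (fun j : 'I_d => corner th es a j.+1) p.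
Proof.
rewrite /mu /mmap mulr_sumr; apply: eq_bigr => m _.
by rewrite mulr_algl -scalerAr.
Qed.

Lemma mu_surj :
  (forall i j : nat, (i <= d)%N -> (j <= d)%N -> i != j -> th i != th j) ->
  (forall i j : nat, (i <= d)%N -> (j <= d)%N -> i != j -> ths i != ths j) ->
  LP_rels d th ths a e as_ es ->
  (forall t : T, exists s : seq (F * seq (gen d)),
          t = \sum_(w <- s) w.1 *: \prod_(g <- w.2) gen_val a e as_ es g) ->
  forall u : T, exists p : {mpoly F[d]}, mu th a es p = es 0%N * u * es 0%N.
Proof.
move=> thi thsi /LP_rels_band rels gens u; have [s ->] := gens u.
have ff : subringP (fun _ : F => True) by [].
have inv (t : nat -> F) : (forall i j, (i <= d)%N -> (j <= d)%N -> i != j -> t i != t j) ->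
    forall i j, (i <= d)%N -> (j <= d)%N -> i != j -> t i - t j != 0 /\ True.
  by move=> tinj x y xd yd xy; rewrite subr_eq0; split=> //; apply: tinj.
have Q0 : exists p : {mpoly F[d]}, mu th a es p = 0.
  by exists (0 : {mpoly F[d]}); rewrite muE mmap0 mulr0.
have QD x y : (exists p : {mpoly F[d]}, mu th a es p = x) ->
    (exists p : {mpoly F[d]}, mu th a es p = y) -> exists p : {mpoly F[d]}, mu th a es p = x + y.
  by move=> [p <-] [q <-]; exists (p + q); rewrite !muE mmapD mulrDr.
have QZ c x : (exists p : {mpoly F[d]}, mu th a es p = x) ->
    exists p : {mpoly F[d]}, mu th a es p = c *: x.
  by move=> [p <-]; exists (c *: p); rewrite !muE mmapZ mulr_algl -scalerAr.
elim: s => [|[c w] s IH]; first by rewrite big_nil mulr0 mul0r.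
rewrite big_cons mulrDr mulrDl; apply: (QD _ _ _ IH); rewrite -scalerAr -scalerAl; apply: (QZ c).
have := gen_word_corner ff (fun _ _ => I) (fun _ _ => I) (inv _ thi) (inv _ thsi) rels
  (ex_intro _ w erefl).
apply: (@span_ind_mod _ _ _ _ (fun z => exists p : {mpoly F[d]}, mu th a es p = z)); [by [] | exact: QD |].
by move=> k _ _ [m ->]; apply: QZ; exists 'X_[m]; rewrite muE mmapX.
Qed.

End Mu.

(** * Specialization of a generic module *)

(* A place of [L] with residue field [F], as a relation: [Res x c] says that [x]
   has residue [c]. It may be undefined on elements that are finite at the
   place. *)
Definition place (F L : fieldType) (iota : F -> L) (Res : L -> F -> Prop) : Prop :=
  [/\ (forall c, Res 0 c -> c = 0), (forall c, Res (iota c) c),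
      (forall x y b c, Res x b -> Res y c -> Res (x - y) (b - c)),
      (forall x y b c, Res x b -> Res y c -> Res (x * y) (b * c)) &
      (forall x b, Res x b -> b != 0 -> Res x^-1 b^-1)].

Section FromGeneric.
Variables (F L : fieldType) (iota : {rmorphism F -> L}) (Res : L -> F -> Prop).
Hypothesis pl : place iota Res.
Variables (d : nat) (th ths : nat -> F).
Hypothesis th_inj : forall i j : nat, (i <= d)%N -> (j <= d)%N -> i != j -> th i != th j.
Hypothesis ths_inj : forall i j : nat, (i <= d)%N -> (j <= d)%N -> i != j -> ths i != ths j.
Variables (Th Ths : nat -> L).
Hypothesis Th_res : forall i, (i <= d)%N -> Res (Th i) (th i).
Hypothesis Ths_res : forall i, (i <= d)%N -> Res (Ths i) (ths i).
Variables (R : algType L) (a as_ : R) (e es : nat -> R).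
Hypothesis rels : LP_rels d Th Ths a e as_ es.
Hypothesis es0_neq0 : es 0%N != 0.
Variable X : 'I_d -> L.
Hypothesis cornerX : forall j : 'I_d, corner Th es a j.+1 = X j *: es 0%N.

Definition valring (x : L) := exists c, Res x c.
Definition maxideal (x : L) := Res x 0.

(** Coefficients are restricted to the ring of the place because the [X j] are themselves in [L],
    hence never independent over [L]. *)
Hypothesis X_indep : forall f : {mpoly L[d]}, (forall m, valring f@_m) -> f.@[X] = 0 -> f = 0.

Let Res_fun x b c : Res x b -> Res x c -> b = c.
Proof.
case: pl => P0 _ PB _ _ xb xc; apply/eqP; rewrite -subr_eq0; apply/eqP; apply: P0.
by rewrite -(subrr x); apply: PB.
Qed.

Lemma valring_subring : subringP valring.
Proof.
case: pl => P0 PC PB PM _; split.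
- by exists 1; rewrite -(rmorph1 iota); apply: PC.
- by move=> x y [b xb] [c yc]; exists (b - c); apply: PB.
- by move=> x y [b xb] [c yc]; exists (b * c); apply: PM.
Qed.

Let Th_O i : (i <= d)%N -> valring (Th i).
Proof. by move=> id; exists (th i); apply: Th_res. Qed.
Let Ths_O i : (i <= d)%N -> valring (Ths i).
Proof. by move=> id; exists (ths i); apply: Ths_res. Qed.

Lemma place_inv (t : nat -> F) (t' : nat -> L) :
  (forall i j : nat, (i <= d)%N -> (j <= d)%N -> i != j -> t i != t j) ->
  (forall i, (i <= d)%N -> Res (t' i) (t i)) ->
  forall i j, (i <= d)%N -> (j <= d)%N -> i != j ->
    t' i - t' j != 0 /\ valring (t' i - t' j)^-1.
Proof.
case: pl => P0 PC PB PM PV ti t'r i j id jd ij.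
have r := PB _ _ _ _ (t'r i id) (t'r j jd).
have n0 : t i - t j != 0 by rewrite subr_eq0; apply: ti.
split; last by exists (t i - t j)^-1; apply: PV.
by apply: contraNneq n0 => E; rewrite E in r; rewrite (P0 _ r).
Qed.

Let brels := LP_rels_band rels.
Let word_x := @gen_word L R d a as_ e es.
Let A := span valring word_x.
Let I := span maxideal word_x.

Let max_val x : maxideal x -> valring x. Proof. by exists 0. Qed.

Let span_sub (P P' : L -> Prop) x : (forall c, P c -> P' c) -> span P word_x x -> span P' word_x x.
Proof. by move=> PP; elim=> [|c g y Pc Gg _ IH]; constructor; auto. Qed.

Lemma span_word_mul (P P' P'' : L -> Prop) x y :
  (forall b c, P b -> P' c -> P'' (b * c)) ->
  span P word_x x -> span P' word_x y -> span P'' word_x (x * y).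
Proof.
move=> PP; elim=> [|b g x' Pb [w wE] _ IH] Sy; first by rewrite mul0r; constructor.
rewrite mulrDl; apply: span_add (IH Sy); rewrite -scalerAl.
have : span P' word_x (g * y).
  elim: Sy => [|c h y' Pc [w' w'E] _ IHy]; first by rewrite mulr0; constructor.
  rewrite mulrDr -scalerAr; apply: span_cons => //.
  by exists (w ++ w'); rewrite big_cat wE w'E.
exact: (span_scale PP Pb).
Qed.

Let A1 : A 1.
Proof.
rewrite -[1]scale1r; apply: span_gen; first by case: valring_subring.
by exists [::]; rewrite big_nil.
Qed.

Let Amod : submodP valring A. Proof. exact: submod_span valring_subring _. Qed.

Let AB x y : A x -> A y -> A (x - y).
Proof.
by case: (Amod) => _ AD _ Ax Ay; apply: AD => //; apply: (submodN valring_subring Amod).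
Qed.

Let AM x y : A x -> A y -> A (x * y).
Proof. by apply: span_word_mul; case: valring_subring. Qed.

Let maxM b c : valring b -> maxideal c -> maxideal (b * c).
Proof.
move=> [k bk] mc; rewrite /maxideal -(mulr0 k); case: pl => _ _ _ PM _; exact: PM.
Qed.

Let maxMr b c : maxideal b -> valring c -> maxideal (b * c).
Proof. by move=> mb vc; rewrite mulrC; apply: maxM. Qed.

Let max0 : maxideal 0. Proof. by case: pl => _ PC _ _ _; have := PC 0; rewrite rmorph0. Qed.

Let AZ' c x : valring c -> A x -> A (c *: x).
Proof. by case: Amod => _ _; apply. Qed.

Let AZ c x : A x -> A (iota c *: x). Proof. by apply: AZ'; exists c; case: pl. Qed.

Let IA x : I x -> A x. Proof. exact: span_sub. Qed.
Let I0 : I 0. Proof. by constructor. Qed.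
Let IB x y : I x -> I y -> I (x - y).
Proof.
move=> Ix Iy; apply: span_add Ix _; rewrite -scaleN1r.
apply: (@span_scale _ _ valring maxideal maxideal) Iy; first exact: maxM.
by apply: subringN valring_subring _ _; case: valring_subring.
Qed.
Let IMl x y : A x -> I y -> I (x * y). Proof. exact: span_word_mul maxM. Qed.
Let IMr x y : I x -> A y -> I (x * y). Proof. exact: span_word_mul maxMr. Qed.

Let es0 : es 0%N * es 0%N = es 0%N.
Proof. by case: brels => -[_ eso] _ _ _ _; rewrite eso. Qed.

Lemma mon_eval m : mon Th es a m = ('X_[m] : {mpoly L[d]}).@[X] *: es 0%N.
Proof.
have E (s : seq 'I_d) : es 0%N * \prod_(j <- s) corner Th es a j.+1 ^+ m j =
      (\prod_(j <- s) X j ^+ m j) *: es 0%N.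
  elim: s => [|j s IH]; first by rewrite !big_nil mulr1 scale1r.
  rewrite !big_cons mulrA cornerX exprZn -scalerAr -scalerAl -scalerA; congr (_ *: _).
  have -> : es 0%N * es 0%N ^+ m j = es 0%N.
    by elim: (m j) => [|n IHn]; rewrite ?expr0 ?mulr1 // exprS mulrA es0.
  exact: IH.
by rewrite /mon E mevalX.
Qed.

Lemma span_mon_eval (P P' : L -> Prop) x c : P' 0 ->
  (forall u v, P' u -> P' v -> P' (u + v)) ->
  (forall b, P b -> P' (c * b)) -> span P (is_mon d Th es a) x ->
  exists f : {mpoly L[d]}, (forall m, P' f@_m) /\ c *: x = f.@[X] *: es 0%N.
Proof.
move=> P0 PD Pc; elim=> [|b g y Pb [m ->] _ [f [fP yE]]].
  by exists 0; split=> [m|]; rewrite ?mcoeff0 // meval0 scale0r scaler0.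
exists ((c * b) *: 'X_[m] + f); split=> [m'|].
  rewrite mcoeffD mcoeffZ mcoeffX; apply: PD => //.
  by case: eqP => _; rewrite ?mulr1 ?mulr0 //; apply: Pc.
by rewrite scalerDr yE mevalD mevalZ scalerDl scalerA mon_eval scalerA.
Qed.

Let ResB x y b c : Res x b -> Res y c -> Res (x - y) (b - c).
Proof. by case: pl => _ _ h _ _; apply: h. Qed.

Let maxD u v : maxideal u -> maxideal v -> maxideal (u + v).
Proof.
move=> mu mv; rewrite /maxideal -(subr0 0) -[v]opprK; apply: ResB => //.
by rewrite -sub0r -[X in Res _ X](subr0 0); apply: ResB.
Qed.

Lemma ideal_corner x : I x -> exists f : {mpoly L[d]},
  (forall m, maxideal f@_m) /\ es 0%N * x * es 0%N = f.@[X] *: es 0%N.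
Proof.
elim=> [|c g y mc gw _ [f [fm yE]]].
  by exists 0; split=> [m|]; rewrite ?mcoeff0 // meval0 scale0r mulr0 mul0r.
have Sg := gen_word_corner valring_subring Th_O Ths_O (place_inv th_inj Th_res)
  (place_inv ths_inj Ths_res) brels gw.
have [h [hm hE]] := span_mon_eval max0 maxD (fun b => maxMr mc) Sg.
exists (h + f); split=> [m|]; first by rewrite mcoeffD; apply: maxD.
by rewrite mulrDr mulrDl yE -scalerAr -scalerAl hE mevalD scalerDl.
Qed.

Lemma eval_eq (f g : {mpoly L[d]}) : (forall m, valring f@_m) -> (forall m, maxideal g@_m) ->
  f.@[X] *: es 0%N = g.@[X] *: es 0%N -> forall m, maxideal f@_m.
Proof.
move=> fv gm E m; suff -> : f = g by [].
apply/eqP; rewrite -subr_eq0; apply/eqP; apply: X_indep.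
  by move=> k; rewrite mcoeffB; case: valring_subring => _ + _; apply => //; apply: max_val.
rewrite mevalB; apply/eqP; rewrite -[_ == 0]orbF -(negbTE es0_neq0) -scaler_eq0 scalerBl E.
by rewrite subrr.
Qed.

(** Otherwise the constant polynomial 1 would agree at [X] with a polynomial over the maximal ideal,
    and by independence 1 would have residue 0. This makes the quotient a nonzero ring. *)
Let I1 : ~ I 1.
Proof.
move=> /ideal_corner[g [gm]]; rewrite mulr1 es0 => E.
have v1 m : valring (1 : {mpoly L[d]})@_m.
  rewrite mcoeff1; case: eqP => _; first by case: valring_subring.
  exact: max_val max0.
have := eval_eq v1 gm; rewrite meval1 scale1r => /(_ E 0%MM).
rewrite mcoeff1 eqxx /maxideal -(rmorph1 iota) => /Res_fun /(_ (_ : Res _ 1)).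
by case: pl => _ PC _ _ _ /(_ (PC 1)) /eqP; rewrite eq_sym oner_eq0.
Qed.

Lemma mu_inj_from_generic (T : algType F) (aT : T) (eT : nat -> T) (asT : T) (esT : nat -> T)
    (f : {mpoly F[d]}) :
  LP_presented d th ths aT eT asT esT -> mu th aT esT f = 0 -> f = 0.
Proof.
case=> relT genT univ mu0.
have [B [pr [prD prM pr1 prZ pr0]]] := quotient_algebra A1 AB AM AZ IA I0 IB IMl IMr I1.
have Agen (g : gen d) : A (gen_val a e as_ es g).
  rewrite -[gen_val _ _ _ _ _]scale1r; apply: span_gen; first by case: valring_subring.
  by exists [:: g]; rewrite big_seq1.
have Aa : A a := Agen (GA d).
have Aas : A as_ := Agen (GAs d).
have Ae (i : 'I_d.+1) : A (e i) := Agen (GE i).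
have Aes (i : 'I_d.+1) : A (es i) := Agen (GEs i).
have A0 : A 0 := IA I0.
have AN x : A x -> A (- x) by move=> Ax; rewrite -sub0r; apply: AB.
have AD x y : A x -> A y -> A (x + y) by case: (Amod) => _ + _; apply.
have prN x : A x -> pr (- x) = - pr x.
  by move=> Ax; apply/eqP; rewrite -subr_eq0 opprK -prD ?addNr; [apply/eqP/pr0| exact: AN|].
(* [c - iota k] has residue 0, so in the quotient an integral scalar acts through its residue. *)
have prZ' c k x : Res c k -> A x -> pr (c *: x) = k *: pr x.
  move=> ck Ax; rewrite -prZ //.
  apply/eqP; rewrite -subr_eq0 -prN; last exact: AZ.
  rewrite -prD; [|by apply: AZ' => //; exists k|by apply: AN; exact: AZ].
  apply/eqP; apply/pr0; first by apply: AB; [apply: AZ' => //; exists k | exact: AZ].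
  rewrite -scalerBl; apply: (@span_scale _ _ maxideal valring maxideal) Ax; first exact: maxMr.
  by rewrite /maxideal -(subrr k); case: pl => _ PC PB _ _; apply: PB.
have pr_sum (J : Type) (s : seq J) (G : J -> R) : (forall j, A (G j)) ->
    A (\sum_(j <- s) G j) /\ pr (\sum_(j <- s) G j) = \sum_(j <- s) pr (G j).
  move=> AG; elim: s => [|j s [As IH]]; first by rewrite !big_nil; split=> //; apply/pr0.
  by rewrite !big_cons prD // IH; split=> //; apply: AD.
have pr_prod (J : Type) (s : seq J) (G : J -> R) : (forall j, A (G j)) ->
    A (\prod_(j <- s) G j) /\ pr (\prod_(j <- s) G j) = \prod_(j <- s) pr (G j).
  move=> AG; elim: s => [|j s [As IH]]; first by rewrite !big_nil.
  by rewrite !big_cons prM // IH; split=> //; apply: AM.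
have pr_exp x n : A x -> A (x ^+ n) /\ pr (x ^+ n) = pr x ^+ n.
  move=> Ax; elim: n => [|n [An IH]]; first by rewrite !expr0.
  by rewrite !exprS prM // IH; split=> //; apply: AM.
have pr00 : pr 0 = 0 by apply/pr0.
case: (rels) => eo [eso [e1 [es1 [aE [asE van]]]]].
have relB : LP_rels d th ths (pr a) (pr \o e) (pr as_) (pr \o es).
  split; first by move=> i j; rewrite /= -prM // eo; case: ifP.
  split; first by move=> i j; rewrite /= -prM // eso; case: ifP.
  split; first by rewrite -pr1 -e1 /= (pr_sum _ _ (fun i : 'I_d.+1 => e i) Ae).2.
  split; first by rewrite -pr1 -es1 /= (pr_sum _ _ (fun i : 'I_d.+1 => es i) Aes).2.
  split.
    have AE (i : 'I_d.+1) : A (Th i *: e i) by apply: AZ' => //; apply: Th_O; rewrite -ltnS.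
    rewrite [in LHS]aE (pr_sum _ _ _ AE).2.
    by apply: eq_bigr => i _; apply: prZ' => //; apply: Th_res; rewrite -ltnS.
  split.
    have AE (i : 'I_d.+1) : A (Ths i *: es i) by apply: AZ' => //; apply: Ths_O; rewrite -ltnS.
    rewrite [in LHS]asE (pr_sum _ _ _ AE).2.
    by apply: eq_bigr => i _; apply: prZ' => //; apply: Ths_res; rewrite -ltnS.
  move=> i j k ijk; have [v1 v2] := van i j k ijk; rewrite /=.
  have [Aak prak] := pr_exp a k Aa; have [Aask prask] := pr_exp as_ k Aas.
  by rewrite -prak -prask -!prM ?v1 ?v2 //; apply: AM.
have [phi [phiD phiZ phiM phi1 phig]] := univ _ _ _ _ _ relB.
have phi0 : phi 0 = 0 by rewrite -(scale0r 0) phiZ scale0r.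
have phiN x : phi (- x) = - phi x by rewrite -scaleN1r phiZ scaleN1r.
have phia : phi aT = pr a := phig (GA d).
have phies : phi (esT 0%N) = pr (es 0%N) := phig (GEs ord0).
have phitau i : (i <= d)%N -> A (tau Th i a) /\ phi (tau th i aT) = pr (tau Th i a).
  rewrite /tau; elim: i => [|i IH] id; first by rewrite !big_ord0 phi1 pr1.
  have [Ai IH'] := IH (ltnW id).
  have Ac : A (Th i)%:A by apply: AZ' => //; apply: Th_O; apply: ltnW.
  rewrite !big_ord_recr /= phiM IH' prM; [|by []|exact: AB].
  split; first by apply: AM => //; apply: AB.
  rewrite phiD phiN phia phiZ phi1 (prD _ _ Aa (AN _ Ac)) prN //.
  by rewrite (prZ' _ (th i)) ?pr1 //; apply: Th_res; apply: ltnW.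
have phicor (j : 'I_d) : A (corner Th es a j.+1) /\
    phi (corner th esT aT j.+1) = pr (corner Th es a j.+1).
  have [At tE] := phitau j.+1 (ltn_ord j).
  have Aet : A (es 0%N * tau Th j.+1 a) := AM (Aes ord0) At.
  split; first exact: AM Aet (Aes ord0).
  by rewrite /corner !phiM phies tE (prM _ _ Aet (Aes ord0)) (prM _ _ (Aes ord0) At).
have phimon (m : 'X_{1..d}) : A (mon Th es a m) /\ phi (mon th esT aT m) = pr (mon Th es a m).
  have [Ap pE] := pr_prod _ (index_enum 'I_d) (fun j : 'I_d => corner Th es a j.+1 ^+ m j)
     (fun j => (pr_exp _ (m j) (phicor j).1).1).
  split; first exact: AM (Aes ord0) Ap.
  rewrite /mon phiM phies (prM _ _ (Aes ord0) Ap) pE.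
  congr (_ * _); rewrite (big_morph phi phiM phi1); apply: eq_bigr => j _.
  have [Ac cE] := phicor j; rewrite (pr_exp _ _ Ac).2 -cE.
  by elim: (m j) => [|n IH]; rewrite ?expr0 ?phi1 // !exprS phiM IH.
pose g := map_mpoly iota f.
have gE m : g@_m = iota f@_m by rewrite mcoeff_map_mpoly.
pose y := \sum_(m <- msupp f) iota f@_m *: mon Th es a m.
have [Ay yE] := pr_sum _ (msupp f) (fun m => iota f@_m *: mon Th es a m)
  (fun m => AZ f@_m (phimon m).1).
(* [y] is [f] with coefficients lifted by [iota], evaluated at the generic corners; its class is
   [phi (mu f)], which is 0. *)
have yI : I y.
  have E : phi (mu th aT esT f) = 0 by rewrite mu0.
  apply/pr0 => //; rewrite yE -[RHS]E /mu (big_morph phi phiD phi0).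
  by apply: eq_bigr => m _; have [Am mE] := phimon m; rewrite prZ // phiZ -mE.
have gS : g = \sum_(m <- msupp f) iota f@_m *: 'X_[m].
  rewrite /g {1}(mpolyE f) raddf_sum; apply: eq_bigr => m _.
  by rewrite /= map_mpolyZ map_mpolyX.
have yX : es 0%N * y * es 0%N = g.@[X] *: es 0%N.
  rewrite /y mulr_sumr mulr_suml gS raddf_sum scaler_suml; apply: eq_bigr => m _.
  by rewrite /= mevalZ mon_eval -!(scalerAr, scalerAl) !es0 scalerA.
have [h [hm hE]] := ideal_corner yI.
have gv m : valring g@_m by rewrite gE; exists f@_m; case: pl.
have gm := eval_eq gv hm (etrans (esym yX) hE).
apply/mpolyP => m; rewrite mcoeff0; apply: (@Res_fun (iota f@_m)).
  by case: pl.
by rewrite -gE; apply: gm.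
Qed.

End FromGeneric.

(** * Tensoring with a two-dimensional module *)

(** The tridiagonal relation: with [c = beta' + 1] this is the commutator of [A] with
    [A^2 S - beta' A S A + S A^2 - rho S]. *)
Definition tridiag (L : fieldType) (R : algType L) (c rho : L) (A S : R) : R :=
  A * A * A * S - c *: (A * A * S * A) + c *: (A * S * A * A) - S * A * A * A
  - rho *: (A * S - S * A).

Section Blocks.
Variables (L : fieldType) (n : nat).
Notation M := 'M[L]_n.+1.
Notation M2 := 'M[L]_((n + n.+1).+1).

Definition blk (a b c d : M) : M2 := block_mx a b c d.

Lemma blkM a b c d a' b' c' d' : blk a b c d * blk a' b' c' d' =
  blk (a * a' + b * c') (a * b' + b * d') (c * a' + d * c') (c * b' + d * d').
Proof. exact: (@mulmx_block L n.+1 n.+1 n.+1 n.+1 n.+1 n.+1). Qed.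

Lemma blkD a b c d a' b' c' d' : blk a b c d + blk a' b' c' d' =
  blk (a + a') (b + b') (c + c') (d + d').
Proof. exact: (@add_block_mx L n.+1 n.+1 n.+1 n.+1). Qed.

Lemma blkZ k a b c d : k *: blk a b c d = blk (k *: a) (k *: b) (k *: c) (k *: d).
Proof. exact: (@scale_block_mx L n.+1 n.+1 n.+1 n.+1). Qed.

Lemma blkN a b c d : - blk a b c d = blk (- a) (- b) (- c) (- d).
Proof. exact: (@opp_block_mx L n.+1 n.+1 n.+1 n.+1). Qed.

Lemma blk1 : blk 1 0 0 1 = 1.
Proof. exact: (esym (@scalar_mx_block L n.+1 n.+1 1)). Qed.

Lemma blk0 : blk 0 0 0 0 = 0.
Proof. exact: (@block_mx0 L n.+1 n.+1 n.+1 n.+1). Qed.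

Lemma blk_eq0 a b c d : a = 0 -> b = 0 -> c = 0 -> d = 0 -> blk a b c d = 0.
Proof. by move=> -> -> -> ->; exact: (@block_mx0 L n.+1 n.+1 n.+1 n.+1). Qed.

(* Action on the tensor product of [V] and [L^2], in block form over [End V]. *)
Definition blkA (q b c : L) (A : M) : M2 := blk (q *: A) (b *: 1) (c *: 1) (q^-1 *: A).

(* Ring laws restated at type [M], so that rewriting leaves the products in [M2] alone. *)
Let nDl (x y z : M) : (x + y) * z = x * z + y * z. Proof. exact: mulrDl. Qed.
Let nDr (x y z : M) : x * (y + z) = x * y + x * z. Proof. exact: mulrDr. Qed.
Let nZl k (x y : M) : (k *: x) * y = k *: (x * y). Proof. by rewrite scalerAl. Qed.
Let nZr k (x y : M) : x * (k *: y) = k *: (x * y). Proof. by rewrite scalerAr. Qed.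
Let nZZ k l (x : M) : k *: (l *: x) = (k * l) *: x. Proof. by rewrite scalerA. Qed.
Let n1l (x : M) : 1 * x = x. Proof. by rewrite mul1r. Qed.
Let n1r (x : M) : x * 1 = x. Proof. by rewrite mulr1. Qed.
Let nA (x y z : M) : x * (y * z) = x * y * z. Proof. by rewrite mulrA. Qed.
Let nE := (nDl, nDr, nZl, nZr, nZZ, n1l, n1r, nA).

Lemma mulr_blkA q b c A q' b' c' (B : M) : blkA q b c A * blkA q' b' c' B =
  blk ((q' * q) *: (A * B) + (b * c') *: 1) ((q * b') *: A + (b / q') *: B)
      ((q' * c) *: B + (q^-1 * c') *: A) ((c * b') *: 1 + (q^-1 / q') *: (A * B)).
Proof. by rewrite /blkA blkM !nE. Qed.

(** Here [bs] and [cs] are arbitrary; in the relation with the roles of [A] and [S] exchanged, [b]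
    and [c] are. Together the two relations constrain only the products [b c] and [bs cs]. *)
Lemma tridiag_blk (q b c bs cs : L) (A S : M) : q != 0 ->
  tridiag (q ^+ 2 + 1 + q^-1 ^+ 2) ((q + q^-1) ^+ 2 * (b * c)) A S = 0 ->
  tridiag (q ^+ 2 + 1 + q^-1 ^+ 2) ((q + q^-1) ^+ 2 * (b * c))
    (blkA q b c A) (blkA q^-1 bs cs S) = 0.
Proof.
move=> q0; set C := _ + q^-1 ^+ 2; set rho := _ ^+ 2 * _.
set N := blkA q b c A; set S' := blkA _ _ _ S; rewrite /tridiag => H.
have -> : N * N * N * S' - C *: (N * N * S' * N) + C *: (N * S' * N * N) - S' * N * N * N =
  N * N * (N * S') - C *: (N * N * (S' * N)) + C *: ((N * S') * (N * N)) - (S' * N) * (N * N).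
  by rewrite !mulrA.
rewrite /N /S' !mulr_blkA.
rewrite !blkM !(blkZ, blkN, blkD).
rewrite !nDl !nDr.
rewrite !nZl !nZr.
rewrite !n1l !n1r.
rewrite !nA.
have {}H i j := congr1 (fun X : M => X i j) H.
move: H.
move: (A * A * A * S) (A * A * S * A) (A * S * A * A) (S * A * A * A).
move: (A * A * A) (A * A * S) (A * S * A) (S * A * A) => m1 m2 m3 m4.
move: (A * A) (A * S) (S * A) => m5 m6 m7 w1 w2 w3 w4 H.
(* The diagonal blocks are [q^2] and [q^-2] times the given relation; the off-diagonal ones cancel
   identically. *)
apply: blk_eq0; apply/matrixP => i j; move: {H}(H i j); rewrite !mxE; rewrite /C /rho => H.
- transitivity (q ^+ 2 * 0); last by rewrite mulr0.
  by rewrite -[in RHS]H; field; rewrite q0 oner_neq0.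
- by field; rewrite q0 ?oner_neq0.
- by field; rewrite q0 ?oner_neq0.
- transitivity (q^-1 ^+ 2 * 0); last by rewrite mulr0.
  by rewrite -[in RHS]H; field; rewrite q0 oner_neq0.
Qed.

End Blocks.

(** * Eigenvalues and [tau] on the tensor product *)

Section Levels.
Variables (L : fieldType).

(* [u q^(2i-k) + w q^(k-2i)], without negative exponents. *)
Definition lev (q u w : L) (k i : nat) : L :=
  u * (q ^+ i) ^+ 2 / q ^+ k + w * q ^+ k / (q ^+ i) ^+ 2.

Definition qint (q : L) (i : nat) : L := (q ^+ i - (q ^+ i)^-1) / (q - q^-1).

Definition lev_shift (q u w : L) (k i : nat) : L :=
  - (u * q ^+ i / q ^+ k.+1 + w * q ^+ k.+1 / q ^+ i).

Variables (n : nat).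
Notation M := 'M[L]_n.+1.

Definition dia (A : M) := blk A 0 0 A.

Lemma blk_eq (a b c d a' b' c' d' : M) : a = a' -> b = b' -> c = c' -> d = d' ->
  blk a b c d = blk a' b' c' d'.
Proof. by move=> -> -> -> ->. Qed.

Variables (q u w b c : L).
Hypothesis q0 : q != 0.
Hypothesis q1 : q ^+ 2 - 1 != 0.
Hypothesis b0 : b != 0.
Hypothesis bcE : b * c = - (u * w) * (q - q^-1) ^+ 2.

(** The quotient of [tau_(i+1)] of the enlarged matrix by [tau_i] of [A], of degree 1 in [A]. The
    coefficients of [A] in it are [q^(i+1)] and [q^-(i+1)], written through quantum integers;
    [lev_shift] is its constant term. *)
Definition tau_factor (k i : nat) (A : M) : 'M[L]_((n + n.+1).+1) :=
  blk ((qint q i.+1 * q - qint q i) *: A + (lev_shift q u w k i) *: 1) ((qint q i.+1 * b) *: 1)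
      ((qint q i.+1 * c) *: 1) ((qint q i.+1 / q - qint q i) *: A + (lev_shift q u w k i) *: 1).

(** Comparing the multiples of the identity is what requires [b c = - u w (q - q^-1)^2]. *)
Lemma tau_factor_step k i (A : M) :
  tau_factor k i A * (blkA q b c A - (lev q u w k.+1 i.+1)%:A) =
  dia (A - (lev q u w k i)%:A) * tau_factor k i.+1 A.
Proof.
have cE : c = - (u * w) * (q - q^-1) ^+ 2 / b by rewrite -bcE mulrC mulKf.
have -> : (lev q u w k.+1 i.+1)%:A =
    blk (lev q u w k.+1 i.+1)%:A 0 0 (lev q u w k.+1 i.+1)%:A :> 'M[L]_((n + n.+1).+1).
  by rewrite -blk1 blkZ !scaler0.
rewrite /blkA blkN blkD /tau_factor /dia !blkM !(oppr0, addr0, mul0r, mulr0, add0r).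
rewrite !(mulrDl, mulrDr, mulrN, mulNr).
have nZl k' (x y : M) : (k' *: x) * y = k' *: (x * y) by rewrite scalerAl.
have nZr k' (x y : M) : x * (k' *: y) = k' *: (x * y) by rewrite scalerAr.
have n1l (x : M) : 1 * x = x by rewrite mul1r.
have n1r (x : M) : x * 1 = x by rewrite mulr1.
rewrite !(nZl, nZr, n1l, n1r).
move: (A * A) => A2.
have x0 : q ^+ i != 0 by rewrite expf_neq0.
have y0 : q ^+ k != 0 by rewrite expf_neq0.
rewrite /lev_shift /lev /qint !exprS cE.
move: (q ^+ i) (q ^+ k) x0 y0 => x y x0 y0.
apply: blk_eq; apply/matrixP => i' j'; rewrite !mxE; field.
all: by rewrite ?x0 ?y0 ?q0 ?b0 -?expr2 ?q1.
Qed.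

(** Taken at [i = k + 1], it shows that tensoring lengthens the list of eigenvalues by one: if
    [tau_(k+1)] kills [A], then [tau_(k+2)] kills the enlarged matrix. *)
Lemma tau_blk k i (A : M) : tau (lev q u w k.+1) i.+1 (blkA q b c A) =
  dia (tau (lev q u w k) i A) * tau_factor k i A.
Proof.
elim: i => [|i IH].
  rewrite /tau big_ord_recl big_ord0 big_ord0 mulr1 /dia blk1 mul1r /tau_factor.
  have -> : qint q 1 = 1 by rewrite /qint expr1 divff //; apply: contraNneq q1 => /eqP;
    rewrite subr_eq0 => /eqP E; rewrite expr2 {2}E divff // subrr.
  have -> : qint q 0 = 0 by rewrite /qint expr0 invr1 subrr mul0r.
  have -> : lev_shift q u w k 0 = - lev q u w k.+1 0.
    by rewrite /lev_shift /lev !expr0 expr1n mulr1 !divr1.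
  have cb x : x%:A = blk x%:A 0 0 x%:A :> 'M[L]_((n + n.+1).+1) by rewrite -blk1 blkZ !scaler0.
  by rewrite cb !mul1r !subr0 /blkA blkN blkD !oppr0 !addr0 !scaleNr.
rewrite {1}/tau big_ord_recr -/(tau _ _ _) /= IH -mulrA tau_factor_step mulrA; congr (_ * _).
by rewrite /dia blkM !(mul0r, mulr0, addr0, add0r) [tau _ i.+1 A]big_ord_recr.
Qed.

End Levels.

Section Vectors.
Variables (L : fieldType) (n : nat).
Notation M := 'M[L]_n.+1.
Implicit Types (v : 'cV[L]_n.+1) (l : 'rV[L]_n.+1).

(** [colb] and [rowb] are the tensors of [v] with the column (1, r) and of [l] with the row (x,
    y). *)
Definition colb v (r : L) : 'cV[L]_((n + n.+1).+1) := col_mx v (r *: v).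
Definition rowb l (x y : L) : 'rV[L]_((n + n.+1).+1) := row_mx (x *: l) (y *: l).

Lemma colb_rowb v l r x y :
  colb v r *m rowb l x y =
  blk (x *: (v *m l)) (y *: (v *m l)) ((r * x) *: (v *m l)) ((r * y) *: (v *m l)).
Proof.
rewrite [LHS](@mul_col_row L n.+1 n.+1 1 n.+1 n.+1); apply: blk_eq;
by rewrite -?scalemxAl -?scalemxAr ?scalerA.
Qed.

Lemma rowb_blk_colb v l r x y (a b c d : M) :
  rowb l x y *m blk a b c d *m colb v r =
  x *: (l *m a *m v) + (x * r) *: (l *m b *m v) + y *: (l *m c *m v) + (y * r) *: (l *m d *m v).
Proof.
rewrite /rowb /colb /blk (@mul_row_block L 1 n.+1 n.+1 n.+1 n.+1) (@mul_row_col L 1 n.+1 n.+1 1).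
rewrite -!scalemxAr !mulmxDl -!scalemxAl scalerDr !scalerA [r * x]mulrC [r * y]mulrC.
by rewrite -!addrA; congr (_ + _); rewrite addrCA.
Qed.

Lemma rowb_colb v l r x y : rowb l x y *m colb v r = (x + y * r) *: (l *m v).
Proof.
rewrite /rowb /colb (@mul_row_col L 1 n.+1 n.+1 1) -!scalemxAr -!scalemxAl scalerA.
by rewrite [r * y]mulrC -scalerDl.
Qed.

End Vectors.

Section CornerStep.
Variables (L : fieldType) (n : nat).
Notation M := 'M[L]_n.+1.

Lemma tau_rec (R : algType L) th i (A : R) : tau th i.+1 A = tau th i A * (A - (th i)%:A).
Proof. by rewrite /tau big_ord_recr. Qed.

(** On [v *m l] the matrix [S] acts by its last eigenvalue, so [tau_factor] becomes a 2 x 2 matrix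
    of scalars. The value of [b c] makes its determinant vanish; [m11] is its upper left entry,
    nonzero because [q^(2k+2) != 1]. *)
Lemma rank_one_step (q u w b c : L) k (S : M) (v : 'cV_n.+1) (l : 'rV_n.+1) :
  q != 0 -> q ^+ 2 - 1 != 0 -> b != 0 -> b * c = - (u * w) * (q - q^-1) ^+ 2 ->
  u != 0 -> q ^+ (k.+1).*2 != 1 ->
  tau (lev q u w k) k.+1 S = 0 -> tau (lev q u w k) k S = v *m l ->
  let m11 := u * (q ^+ k.*2.+1 - q^-1) in
  tau (lev q u w k.+1) k.+1 (blkA q b c S) =
    colb v (qint q k.+1 * c / m11) *m rowb l m11 (qint q k.+1 * b).
Proof.
move=> q0 q1 b0 bcE u0 qk S0 SE m11.
have m110 : m11 != 0.
  rewrite mulf_neq0 // subr_eq0; apply: contraNneq qk => E.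
  by rewrite doubleS exprS E mulfV.
rewrite tau_blk // SE colb_rowb /dia /tau_factor blkM !(mul0r, addr0, add0r).
have SS : (v *m l) * S = lev q u w k k *: (v *m l).
  by move: S0; rewrite tau_rec SE mulrBr -scalerAr mulr1 => /eqP; rewrite subr_eq0 => /eqP.
have x0 : q ^+ k != 0 by rewrite expf_neq0.
have cE : c = - (u * w) * (q - q^-1) ^+ 2 / b by rewrite -bcE mulrC mulKf.
have m11E : m11 = u * (q * (q ^+ k) ^+ 2 - q^-1) by rewrite /m11 exprS -exprM muln2.
move: m110; rewrite m11E => m110.
apply: blk_eq; rewrite ?mulrDr -?scalerAr ?mulr1 ?SS ?scalerA -?scalerDl; congr (_ *: _).
all: rewrite /lev_shift /lev /qint !exprS ?cE; move: (q ^+ k) x0 m110 => x x0 m110.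
all: have m110' : u * (q * (x * x)) * q + u * -1 != 0 by
  rewrite (_ : _ + _ = q * (u * (q * x ^+ 2 - q^-1))); [exact: mulf_neq0 | field].
all: by field; rewrite ?q0 ?b0 ?x0 ?m110' -?expr2 ?q1.
Qed.

(** [tau_factor] has degree 1 in [A], and [tau_i(A) A = tau_(i+1)(A) + lev_i tau_i(A)]; hence only
    two neighbouring values for the smaller module enter. *)
Lemma corner_step (q u w b c : L) k i (A : M) (v : 'cV_n.+1) (l : 'rV_n.+1) r x y :
  q != 0 -> q ^+ 2 - 1 != 0 -> b != 0 -> b * c = - (u * w) * (q - q^-1) ^+ 2 ->
  rowb l x y *m tau (lev q u w k.+1) i.+1 (blkA q b c A) *m colb v r =
  (q ^+ i.+1 * x + (q ^+ i.+1)^-1 * (y * r)) *: (l *m tau (lev q u w k) i.+1 A *m v) +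
  ((q ^+ i.+1 * x + (q ^+ i.+1)^-1 * (y * r)) * lev q u w k i + lev_shift q u w k i * (x + y * r)
    + qint q i.+1 * (b * (x * r) + c * y)) *: (l *m tau (lev q u w k) i A *m v).
Proof.
move=> q0 q1 b0 bcE.
rewrite tau_blk // /dia /tau_factor blkM !(mul0r, addr0, add0r) rowb_blk_colb.
have tA : tau (lev q u w k) i A * A =
    tau (lev q u w k) i.+1 A + lev q u w k i *: tau (lev q u w k) i A.
  by rewrite tau_rec mulrBr -scalerAr mulr1 subrK.
move: (lev q u w k i) (lev_shift q u w k i) tA => t s tA.
rewrite !mulrDr -!scalerAr !mulr1 tA !scalerDr !mulmxDr !mulmxDl -!scalemxAr -!scalemxAl.
have x0 : q ^+ i != 0 by rewrite expf_neq0.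
move: (l *m tau _ i.+1 A *m v) (l *m tau _ i A *m v) => g1 g0.
apply/matrixP => i' j'; rewrite !mxE /qint !exprS.
move: (q ^+ i) x0 (g1 i' j') (g0 i' j') => z z0 {}g1 {}g0; field.
by rewrite q0 z0 -expr2 q1.
Qed.

End CornerStep.

(** * Algebraic independence *)

Lemma mpoly_rmorph_ext (n : nat) (R S : comNzRingType) (f g : {rmorphism {mpoly R[n]} -> S}) :
  (forall c, f c%:MP = g c%:MP) -> (forall i, f 'X_i = g 'X_i) -> forall p, f p = g p.
Proof.
move=> fgC fgX p; rewrite (mpolyE p) !rmorph_sum; apply: eq_bigr => m _ /=.
rewrite -mul_mpolyC !rmorphM fgC mpolyXE_id !rmorph_prod; congr (_ * _).
by apply: eq_bigr => i _; rewrite !rmorphXn /= fgX.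
Qed.

Definition alg_indep (K L : fieldType) (iota : {rmorphism K -> L}) (k : nat) (X : nat -> L) :=
  forall f : {mpoly K[k]}, (map_mpoly iota f).@[fun j : 'I_k => X j.+1] = 0 -> f = 0.

Section Triangular.
Variables (K L : fieldType) (iota : {rmorphism K -> L}) (k : nat).
Variables (X Z : nat -> L) (al be : nat -> K).
Hypothesis X0 : X 0%N = 1.
Hypothesis al0 : forall i, (i < k)%N -> al i != 0.
Hypothesis ZE : forall i, (i < k)%N -> Z i.+1 = iota (al i) * X i.+1 + iota (be i) * X i.

Let var (i : nat) : {mpoly K[k]} := if i is j.+1 then
  (if insub j is Some o then 'X_o else 0) else 1.

Let varS (j : 'I_k) : var j.+1 = 'X_j. Proof. by rewrite /var valK. Qed.

Let phi (j : 'I_k) : {mpoly K[k]} := al j *: var j.+1 + be j *: var j.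

Let psi := fix psi (i : nat) : {mpoly K[k]} :=
  if i is j.+1 then (al j)^-1 *: (var j.+1 - be j *: psi j) else 1.

(** The [Z] arise from the [X] by a substitution over [K] that is triangular with nonzero diagonal;
    [psi] is its inverse. [var 0 = 1] mirrors [X 0 = 1]. *)
Lemma alg_indep_triangular : alg_indep iota k X -> alg_indep iota k Z.
Proof.
move=> Xi c; pose subst : {rmorphism {mpoly K[k]} -> {mpoly K[k]}} := mmap (@mpolyC k K) phi.
pose subst' : {rmorphism {mpoly K[k]} -> {mpoly K[k]}} :=
  mmap (@mpolyC k K) (fun j : 'I_k => psi j.+1).
have varX (i : nat) : (i <= k)%N -> (map_mpoly iota (var i)).@[fun j : 'I_k => X j.+1] = X i.
  case: i => [|i] ik; first by rewrite /= rmorph1 meval1 X0.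
  by rewrite (varS (Ordinal ik)) map_mpolyX mevalXU.
have E1 f : (map_mpoly iota f).@[fun j : 'I_k => Z j.+1] =
   (map_mpoly iota (subst f)).@[fun j : 'I_k => X j.+1].
  pose g1 := meval (fun j : 'I_k => Z j.+1) \o map_mpoly iota : {rmorphism _ -> _}.
  pose g2 := meval (fun j : 'I_k => X j.+1) \o map_mpoly iota \o subst : {rmorphism _ -> _}.
  apply: (@mpoly_rmorph_ext k K L g1 g2) => [a|i]; rewrite /g1 /g2 /subst /=.
    by rewrite mmapC map_mpolyC !mevalC.
  rewrite mmapX mmap1U map_mpolyX mevalXU ZE // /phi rmorphD /= !map_mpolyZ mevalD !mevalZ.
  by rewrite (varX i.+1) ?ltn_ord // (varX i) // ltnW ?ltn_ord.
have E2 f : subst' (subst f) = f.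
  apply: (@mpoly_rmorph_ext k K _ (subst' \o subst) idfun) => [a|i]; rewrite /subst /subst' /=.
    by rewrite !mmapC.
  rewrite !mmapX mmap1U /phi rmorphD /= !mmapZ !mul_mpolyC.
  have vs (j : nat) : (j <= k)%N -> mmap (@mpolyC k K) (fun j : 'I_k => psi j.+1) (var j) = psi j.
    case: j => [|j] jk; first by rewrite /= rmorph1.
    by rewrite (varS (Ordinal jk)) mmapX mmap1U.
  rewrite (vs i.+1) // (vs i) 1?ltnW //= scalerA divff ?al0 // scale1r.
  by rewrite -/(var i.+1) varS subrK.
by rewrite E1 => /Xi E; rewrite -(E2 c) E /subst' /= mmap0.
Qed.

End Triangular.

Section IndepStep.
Variables (K L L' : fieldType) (iota : {rmorphism K -> L}) (iota' : {rmorphism L -> L'}).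
Variables (k : nat) (X : nat -> L) (X' : nat -> L') (y : L').
Variables (p s t : nat -> K).
Hypothesis X0 : X 0%N = 1.
Hypothesis Xk : X k.+1 = 0.
Hypothesis Xi : alg_indep iota k X.
Hypothesis p0 : forall i, (i < k)%N -> p i != 0.
Hypothesis s0 : s k != 0.
Hypothesis y_trans : forall f : {poly L}, (map_poly iota' f).[y] = 0 -> f = 0.
Hypothesis X'E : forall i, (i <= k)%N -> X' i.+1 =
  iota' (iota (p i) * X i.+1) + (iota' (iota (s i)) * y + iota' (iota (t i))) * iota' (X i).

Let XY (i : nat) : {poly L} :=
  (iota (p i) * X i.+1)%:P + (iota (s i) *: 'X + (iota (t i))%:P) * (X i)%:P.

Let Phi : {rmorphism {mpoly K[k.+1]} -> {poly {mpoly K[k]}}} :=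
  mmap (polyC \o @mpolyC k K)
    (fun i => if unlift ord_max i is Some j then ('X_j)%:P else 'X).

Let Psi0 : {rmorphism {mpoly K[k]} -> {mpoly K[k.+1]}} :=
  mmap (@mpolyC k.+1 K) (fun j : 'I_k => 'X_(lift ord_max j)).

Let PhiK f : (map_poly Psi0 (Phi f)).['X_ord_max] = f.
Proof.
pose g := horner_eval ('X_ord_max) \o map_poly Psi0 \o Phi : {rmorphism _ -> _}.
apply: (@mpoly_rmorph_ext k.+1 K _ g idfun) => [a|i]; rewrite /g /Phi /= /horner_eval.
  by rewrite mmapC /= map_polyC /= hornerC /Psi0 /= mmapC.
rewrite mmapX mmap1U; case: unliftP => [j ->|->].
  by rewrite map_polyC /= hornerC /Psi0 /= mmapX mmap1U.
by rewrite map_polyX hornerX.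
Qed.

Let Xk_neq0 : X k != 0.
Proof.
case: (posnP k) => [->|k0]; first by rewrite X0 oner_eq0.
have kl : (k.-1 < k)%N by rewrite prednK.
apply/eqP => E; have := @Xi 'X_(Ordinal kl); rewrite map_mpolyX mevalXU /= prednK // => /(_ E).
move/(congr1 (fun f : {mpoly K[k]} => f@_(U_(Ordinal kl)))).
by rewrite mcoeffX eqxx mcoeff0 => /eqP; rewrite oner_eq0.
Qed.

(* Since [y] is transcendental, a relation [f] among the [X' i] is an identity in
   [L[y]], where [X' k.+1] becomes [XY k], nonzero because [X k.+1 = 0] but
   [X k != 0]. Divide [f] by the largest power of its last variable and set [y]
   to the root of [XY k]: this leaves a relation among the remaining values,
   which are a triangular transform of the [X i]. *)
Lemma alg_indep_step : alg_indep (iota' \o iota : {rmorphism K -> L'}) k.+1 X'.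
Proof.
move=> f f0; apply/eqP; apply/negP => /negP fn0.
pose Ev : {rmorphism {mpoly K[k]} -> {poly L}} := mmap (polyC \o iota) (fun j : 'I_k => XY j).
pose H : {rmorphism {poly {mpoly K[k]}} -> {poly L}} := horner_eval (XY k) \o map_poly Ev.
pose hy : {rmorphism {poly L} -> L'} := horner_eval y \o map_poly iota'.
have hyC a : hy a%:P = iota' a by rewrite /hy /= /horner_eval map_polyC hornerC.
have hyX : hy 'X = y by rewrite /hy /= /horner_eval map_polyX hornerX.
have hyXY i : (i <= k)%N -> hy (XY i) = X' i.+1.
  move=> ik; rewrite X'E // /XY -mul_polyC.
  by rewrite (rmorphD hy) (rmorphM hy) (rmorphD hy) (rmorphM hy) hyX !hyC.
have HC c : H c%:P = Ev c by rewrite /H /= /horner_eval map_polyC hornerC.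
have HX : H 'X = XY k by rewrite /H /= /horner_eval map_polyX hornerX.
have EvC a : Ev a%:MP = (iota a)%:P by rewrite /Ev /= mmapC.
have EvX (j : 'I_k) : Ev 'X_j = XY j by rewrite /Ev /= mmapX mmap1U.
have HE : hy (H (Phi f)) = 0.
  rewrite -f0.
  pose g1 := hy \o H \o Phi : {rmorphism _ -> _}.
  pose g2 := meval (fun j : 'I_k.+1 => X' j.+1) \o map_mpoly (iota' \o iota) : {rmorphism _ -> _}.
  apply: (@mpoly_rmorph_ext k.+1 K L' g1 g2) => [a|i].
    have -> : g2 a%:MP = iota' (iota a) by rewrite /g2 /= map_mpolyC mevalC.
    have PhiC : Phi a%:MP = a%:MP%:P by rewrite /Phi /= mmapC.
    by rewrite -[LHS]/(hy (H (Phi a%:MP))) PhiC HC EvC hyC.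
  have -> : g2 'X_i = X' i.+1 by rewrite /g2 /= map_mpolyX mevalXU.
  have PhiX : Phi 'X_i = if unlift ord_max i is Some j then ('X_j)%:P else 'X.
    by rewrite /Phi /= mmapX mmap1U.
  rewrite -[LHS]/(hy (H (Phi 'X_i))) PhiX; case: unliftP => [j ->|->].
    by rewrite HC EvX hyXY ?(ltnW (ltn_ord j)) // lift_max.
  by rewrite HX hyXY.
have {}HE : H (Phi f) = 0 by apply: y_trans; exact: HE.
have Pn0 : Phi f != 0.
  by apply: contraNneq fn0 => E; rewrite -(PhiK f) E rmorph0 horner0.
have [e [Q]] := multiplicity_XsubC (Phi f) 0; rewrite Pn0 implyTb => rootQ PE.
have XY0 : XY k != 0.
  apply/eqP => E; have := congr1 (fun g : {poly L} => g`_1) E.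
  rewrite /XY Xk mulr0 polyC0 add0r mulrDl coefD coefMC coefZ coefX eqxx mulr1.
  rewrite -polyCM coefC coef0 addr0 => /eqP; rewrite mulf_eq0 (negbTE Xk_neq0) orbF fmorph_eq0.
  by rewrite (negbTE s0).
have HQ : H Q = 0.
  move: HE; rewrite PE (rmorphM H) (rmorphXn H) => /eqP; rewrite mulf_eq0 expf_eq0.
  have -> : H ('X - 0%:P) = XY k by rewrite subr0 HX.
  by rewrite (negbTE XY0) andbF orbF => /eqP.
pose y0 := - (iota (t k) / iota (s k)).
have XYy0 : (XY k).[y0] = 0.
  rewrite /XY Xk mulr0 polyC0 add0r hornerM hornerD hornerZ hornerX !hornerC /y0.
  by rewrite mulrN mulrCA divff ?fmorph_eq0 // mulr1 addNr mul0r.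
have /factor_theorem[Q1 Q1E] : root (Q - (Q.[0])%:P) 0.
  by rewrite /root hornerD hornerN hornerC subrr.
have : (H Q).[y0] = (Ev Q.[0]).[y0].
  have -> : Q = Q1 * ('X - 0%:P) + (Q.[0])%:P by rewrite -Q1E subrK.
  rewrite [in LHS]rmorphD rmorphM hornerD hornerM.
  have -> : H ('X - 0%:P) = XY k by rewrite subr0 HX.
  rewrite XYy0 mulr0 add0r HC.
  by rewrite hornerD hornerM hornerXsubC subrr mulr0 add0r hornerC.
rewrite HQ horner0.
set c := Q.[0] => Ec.
have EvE : (Ev c).[y0] = (map_mpoly iota c).@[fun j : 'I_k => (XY j).[y0]].
  pose g1 := horner_eval y0 \o Ev : {rmorphism _ -> _}.
  pose g2 := meval (fun j : 'I_k => (XY j).[y0]) \o map_mpoly iota : {rmorphism _ -> _}.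
  apply: (@mpoly_rmorph_ext k K L g1 g2) => [a|i]; rewrite /g1 /g2 /Ev /= /horner_eval.
    by rewrite mmapC /= hornerC map_mpolyC mevalC.
  by rewrite mmapX mmap1U map_mpolyX mevalXU.
move: rootQ; rewrite /root -/c => /eqP; apply.
pose Z i := if i is j.+1 then (XY j).[y0] else 1.
apply: (@alg_indep_triangular K L iota k X Z p (fun i => s i * - (t k / s k) + t i) X0 p0) Xi _ _.
  move=> i ik; rewrite /Z /XY hornerD hornerC hornerM hornerD hornerZ hornerX !hornerC.
  by rewrite rmorphD rmorphM rmorphN fmorph_div.
by rewrite -EvE -Ec.
Qed.

End IndepStep.

(** After clearing denominators, the term with the top power of [N] has strictly larger degree than
    all the others. *)
Lemma ratio_transcendental (L L' : fieldType) (j : {rmorphism {poly L} -> L'}) (N D : {poly L}) :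
  injective j -> D != 0 -> (size D < size N)%N ->
  forall f : {poly L}, (map_poly (j \o polyC) f).[j N / j D] = 0 -> f = 0.
Proof.
move=> j_inj D0 DN f fND; apply/eqP; apply/negP => /negP fn0.
have N0 : N != 0 by rewrite -size_poly_gt0; lia.
set m := (size f).-1; have sf : size f = m.+1 by rewrite prednK ?size_poly_gt0.
pose T i := f`_i *: (N ^+ i * D ^+ (m - i)).
have sT : \sum_(i < m.+1) T i = 0.
  apply/j_inj; rewrite rmorph0 rmorph_sum /=.
  transitivity (j D ^+ m * (map_poly (j \o polyC) f).[j N / j D]); last by rewrite fND mulr0.
  rewrite horner_coef size_map_poly sf mulr_sumr; apply: eq_bigr => i _.
  have im : (i <= m)%N by rewrite -ltnS.
  rewrite coef_map /T -mul_polyC !rmorphM !rmorphXn /= expr_div_n.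
  have D0' : j D ^+ i != 0.
    by rewrite expf_neq0 // -(rmorph0 j) (inj_eq j_inj).
  have -> : j D ^+ m = j D ^+ (m - i) * j D ^+ i by rewrite -exprD subnK.
  by rewrite [RHS]mulrACA [_ * (_ / _)]mulrCA divff // mulr1 -mulrA [RHS]mulrC -mulrA.
move: sT; rewrite big_ord_recr /= addrC => /eqP; rewrite addr_eq0 => /eqP E.
have fm : f`_m != 0 by rewrite -[f`_m]/(lead_coef f) lead_coef_eq0.
have : (size (T m) <= size (\sum_(i < m) T i)%R)%N by rewrite E size_polyN.
rewrite leqNgt => /negP; apply.
have sNm : size (T m) = ((size N).-1 * m).+1.
  rewrite /T subnn expr0 mulr1 size_scale // -size_exp prednK // size_poly_gt0.
  by rewrite expf_neq0.
rewrite sNm ltnS; apply: (leq_trans (size_sum _ _ _)).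
apply/bigmax_leqP => i _; have im := ltn_ord i.
apply: (leq_trans (size_scale_leq _ _)).
apply: (leq_trans (size_polyMleq _ _)).
have s1 : size (N ^+ i) = ((size N).-1 * i).+1.
  by rewrite -size_exp prednK // size_poly_gt0 expf_neq0.
have s2 : size (D ^+ (m - i)) = ((size D).-1 * (m - i)).+1.
  by rewrite -size_exp prednK // size_poly_gt0 expf_neq0.
rewrite s1 s2 addSn /= addnS.
have sD : (0 < size D)%N by rewrite size_poly_gt0.
rewrite -[X in (_ <= _ * X)%N](subnKC (ltnW im)) mulnDr -addnS leq_add2l.
apply: (@leq_trans ((size D).-1.+1 * (m - i))).
  by rewrite mulSn -addn1 addnC leq_add2r subn_gt0.
rewrite leq_mul2r prednK //; apply/orP; right.
by rewrite -ltnS prednK // size_poly_gt0.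
Qed.

(** Adjoins the parameter [z] of one new tensor factor. The combination [m / z + n z] is the ratio
    of [m + n X^2] to [X], of degrees 2 and 1. *)
Lemma transcendental_ext (L : fieldType) :
  exists (L' : fieldType) (f : {rmorphism L -> L'}) (z : L'),
  z != 0 /\ forall m n, n != 0 -> forall p : {poly L},
    (map_poly f p).[f m / z + f n * z] = 0 -> p = 0.
Proof.
pose j : {rmorphism {poly L} -> {fraction {poly L}}} := @tofrac {poly L}.
have j_inj : injective j by move=> x y /eqP; rewrite tofrac_eq => /eqP.
exists {fraction {poly L}}, (j \o polyC : {rmorphism _ -> _}), (j 'X).
have z0 : j 'X != 0 by rewrite -(rmorph0 j) (inj_eq j_inj) polyX_eq0.
split=> // m n n0 p pE.
pose N := m%:P + n *: 'X ^+ 2.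
have sN : size N = 3.
  by rewrite /N addrC size_polyDl size_scale // size_polyXn // size_polyC; case: (m != 0).
apply: (@ratio_transcendental L _ j N 'X j_inj); rewrite ?polyX_eq0 ?sN ?size_polyX //.
rewrite -[RHS]pE; congr (_ .[_]).
rewrite /N -mul_polyC rmorphD rmorphM rmorphXn /= mulrDl; congr (_ + _).
by rewrite expr2 mulrA mulfK.
Qed.

(** * The generic module *)

Section MapMatrix.
Variables (L L' : fieldType) (f : {rmorphism L -> L'}) (n : nat).

Lemma map_mx_tau (th : nat -> L) i (A : 'M[L]_n.+1) :
  map_mx f (tau th i A) = tau (f \o th) i (map_mx f A).
Proof.
elim: i => [|i IH]; first by rewrite /tau !big_ord0 map_mx1.
by rewrite !tau_rec [LHS]map_mxM IH; congr (_ * _); rewrite map_mxB map_mxZ map_mx1.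
Qed.

Lemma map_mx_tridiag c rho (A S : 'M[L]_n.+1) :
  map_mx f (tridiag c rho A S) = tridiag (f c) (f rho) (map_mx f A) (map_mx f S).
Proof. by rewrite /tridiag !(map_mxB, map_mxD, map_mxZ, map_mxM). Qed.

Lemma rmorph_lev (q u w : L) k i : f (lev q u w k i) = lev (f q) (f u) (f w) k i.
Proof. by rewrite /lev rmorphD !rmorphM !fmorphV !rmorphXn. Qed.

Lemma rmorph_lev_shift (q u w : L) k i : f (lev_shift q u w k i) = lev_shift (f q) (f u) (f w) k i.
Proof. by rewrite /lev_shift rmorphN rmorphD !rmorphM !fmorphV !rmorphXn. Qed.

Lemma rmorph_qint (q : L) i : f (qint q i) = qint (f q) i.
Proof. by rewrite /qint fmorph_div !rmorphB !fmorphV !rmorphXn. Qed.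

End MapMatrix.

Lemma eq_tau (L : fieldType) (R : algType L) (th th' : nat -> L) i (A : R) :
  (forall j, (j < i)%N -> th j = th' j) -> tau th i A = tau th' i A.
Proof. by move=> E; apply: eq_bigr => j _; rewrite E. Qed.

Lemma qintV (L : fieldType) (q : L) i : qint q^-1 i = qint q i.
Proof. by rewrite /qint exprVn !invrK -opprB -[X in _ / X]opprB invrN mulrNN. Qed.

Section Rep.
Variables (K : fieldType) (q u w us ws : K) (d : nat).
Hypothesis q0 : q != 0.
Hypothesis qn : forall m, (0 < m)%N -> q ^+ m != 1.
Hypothesis u0 : u != 0.
Hypothesis w0 : w != 0.
Hypothesis us0 : us != 0.
Hypothesis ws0 : ws != 0.
Hypothesis nz : forall e, (e < d)%N -> ws * (q ^+ e) ^+ 2 - us != 0.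

Definition nrm (L : fieldType) (q u w : L) := - (u * w) * (q - q^-1) ^+ 2.

(** The coefficients are the same for any number of tensor factors, so the relation can be carried
    through the induction. *)
Definition td_rel (L : fieldType) (R : algType L) (q u w : L) (A S : R) :=
  tridiag (q ^+ 2 + 1 + q^-1 ^+ 2) ((q + q^-1) ^+ 2 * nrm q u w) A S = 0.

Lemma map_td_rel (L L' : fieldType) (g : {rmorphism L -> L'}) n (x y z : L) (A S : 'M[L]_n.+1) :
  td_rel x y z A S -> td_rel (g x) (g y) (g z) (map_mx g A) (map_mx g S).
Proof.
move=> /(congr1 (map_mx g)); rewrite map_mx_tridiag map_mx0 /td_rel /nrm.
by rewrite !(rmorphD, rmorphM, rmorphN, rmorphXn, fmorphV, rmorph1).
Qed.

Definition corner_val (L : fieldType) n (th : nat -> L) (A : 'M[L]_n.+1)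
    (v : 'cV_n.+1) (l : 'rV_n.+1) i : L :=
  (l *m tau th i A *m v) 0 0 / (l *m v) 0 0.

(* The eigenvalues of [S] are listed in reverse order, whence [q^-1], so that
   [tau_k(S)] is proportional to [e*_0]. *)
Definition rep (k : nat) : Prop :=
  exists (L : fieldType) (f : {rmorphism K -> L}) (n : nat) (A S : 'M[L]_n.+1)
    (v : 'cV[L]_n.+1) (l : 'rV[L]_n.+1),
  [/\ tau (lev (f q) (f u) (f w) k) k.+1 A = 0 /\
        tau (lev (f q)^-1 (f us) (f ws) k) k.+1 S = 0,
      td_rel (f q) (f u) (f w) A S /\ td_rel (f q)^-1 (f us) (f ws) S A,
      tau (lev (f q)^-1 (f us) (f ws) k) k S = v *m l,
      (l *m v) 0 0 != 0 &
      alg_indep f k (corner_val (lev (f q) (f u) (f w) k) A v l)].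

Lemma tridiag_comm (L : fieldType) (R : algType L) c rho (A S : R) :
  A * S = S * A -> tridiag c rho A S = 0.
Proof.
move=> AS.
have E1 : A * A * S * A = A * A * A * S by rewrite -mulrA -AS mulrA.
have E2 : A * S * A * A = A * A * S * A by rewrite -[A * S * A]mulrA -AS mulrA.
have E3 : S * A * A * A = A * S * A * A by rewrite -AS.
by rewrite /tridiag E3 E2 E1 AS subrK !subrr scaler0 subr0.
Qed.

Lemma rep0 : rep 0.
Proof.
exists K, (idfun : {rmorphism K -> K}), 0%N, (lev q u w 0 0)%:A, (lev q^-1 us ws 0 0)%:A, 1%:M, 1%:M.
split.
- by rewrite /tau !big_ord1 !subrr.
- by split; apply: tridiag_comm; rewrite -!(scalerAl, scalerAr) !scalerA mulrC.
- by rewrite /tau big_ord0 mulmx1.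
- by rewrite mulmx1 mxE eqxx oner_eq0.
- move=> p; have -> : p = (p@_0)%:MP.
    apply/mpolyP => m; rewrite mcoeffC; have -> : m = 0%MM by apply/mnmP => [[]].
    by rewrite eqxx mulr1.
  by rewrite map_mpolyC mevalC /= => ->; rewrite mpolyC0.
Qed.

(* Coefficients of the recurrence [X'_(i+1) = p_i X_(i+1) + (s_i y + t_i) X_i]
   between the corner values of consecutive modules. *)
Let D k := ws * q ^+ k - us / q ^+ k.
Let p k i := (ws * q ^+ k / q ^+ i.+1 - us * q ^+ i.+1 / q ^+ k) / D k.
Let s k i := qint q i.+1 * qint q k.+1 / ((q ^+ k.+1 - (q ^+ k.+1)^-1) * D k).
Let t k i := p k i * lev q u w k i + lev_shift q u w k i.

Let qk0 k : q ^+ k != 0. Proof. by rewrite expf_neq0. Qed.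

Let q_qV m : (0 < m)%N -> q ^+ m - (q ^+ m)^-1 != 0.
Proof.
move=> m0; rewrite subr_eq0; have := @qn (m + m)%N; rewrite addn_gt0 m0 => /(_ isT).
by apply: contraNneq => E; rewrite exprD {2}E mulfV.
Qed.

Let D0 k : (k < d)%N -> D k != 0.
Proof.
move=> /nz; apply: contraNneq => E.
have -> : ws * (q ^+ k) ^+ 2 - us = q ^+ k * D k.
  by rewrite /D; move: (q ^+ k) (qk0 k) => x x0; field.
by rewrite E mulr0.
Qed.

Let p0 k i : (k < d)%N -> (i < k)%N -> p k i != 0.
Proof.
move=> kd ik; rewrite mulf_neq0 ?invr_eq0 ?D0 //.
have := @nz (k - i.+1) ltac:(lia); apply: contraNneq => E.
have kE : q ^+ k = q ^+ (k - i.+1) * q ^+ i.+1 by rewrite -exprD subnK.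
have -> : ws * (q ^+ (k - i.+1)) ^+ 2 - us =
    q ^+ (k - i.+1) * (ws * q ^+ k / q ^+ i.+1 - us * q ^+ i.+1 / q ^+ k).
  rewrite kE; move: (q ^+ (k - i.+1)) (q ^+ i.+1) (qk0 (k - i.+1)) (qk0 i.+1) => x y x0 y0.
  by field; rewrite y0 x0.
by rewrite E mulr0.
Qed.

Let qint0 i : (0 < i)%N -> qint q i != 0.
Proof.
by move=> i0; rewrite mulf_neq0 ?invr_eq0 ?q_qV //; have := q_qV (isT : 0 < 1)%N; rewrite expr1.
Qed.

Let s0 k : (k < d)%N -> s k k != 0.
Proof.
move=> kd; apply: mulf_neq0; first by apply: mulf_neq0; apply: qint0.
by rewrite invr_eq0; apply: mulf_neq0; [apply: q_qV | apply: D0].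
Qed.

Lemma rep_step k : (k < d)%N -> rep k -> rep k.+1.
Proof.
move=> kd [L [f [n [A [S [v [l [[tauA tauS] [tdA tdS] rk lv0 ind]]]]]]]].
have [L' [g [z [z0 ztr]]]] := transcendental_ext L.
pose h : {rmorphism K -> L'} := g \o f.
pose A' := map_mx g A; pose S' := map_mx g S; pose v' := map_mx g v; pose l' := map_mx g l.
(* [c] and [cs] are dictated by the two products. Rescaling the basis of the new factor normalizes
   [b] to 1, and [bs = z] is the one free parameter left. *)
pose c := nrm (h q) (h u) (h w); pose bs := z; pose cs := nrm (h q)^-1 (h us) (h ws) / z.
have hq0 : h q != 0 by rewrite fmorph_eq0.
have hqn m : (0 < m)%N -> h q ^+ m != 1 by rewrite -rmorphXn fmorph_eq1; apply: qn.
have hq1 : h q ^+ 2 - 1 != 0 by rewrite subr_eq0 hqn.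
have hqV1 : (h q)^-1 ^+ 2 - 1 != 0.
  by rewrite subr_eq0 exprVn invr_eq1 hqn.
have gE : (fun j => g (lev (f q) (f u) (f w) k j)) =1 lev (h q) (h u) (h w) k.
  by move=> j; rewrite rmorph_lev.
have gsE : (fun j => g (lev (f q)^-1 (f us) (f ws) k j)) =1 lev (h q)^-1 (h us) (h ws) k.
  by move=> j; rewrite rmorph_lev fmorphV.
have tauE i : map_mx g (tau (lev (f q) (f u) (f w) k) i A) = tau (lev (h q) (h u) (h w) k) i A'.
  by rewrite map_mx_tau; apply: eq_tau => j _; apply: gE.
have tauSE i : map_mx g (tau (lev (f q)^-1 (f us) (f ws) k) i S) =
    tau (lev (h q)^-1 (h us) (h ws) k) i S'.
  by rewrite map_mx_tau; apply: eq_tau => j _; apply: gsE.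
have tauA' : tau (lev (h q) (h u) (h w) k) k.+1 A' = 0 by rewrite -tauE tauA map_mx0.
have tauS' : tau (lev (h q)^-1 (h us) (h ws) k) k.+1 S' = 0 by rewrite -tauSE tauS map_mx0.
have rk' : tau (lev (h q)^-1 (h us) (h ws) k) k S' = v' *m l' by rewrite -tauSE rk map_mxM.
have bcA : 1 * c = - (h u * h w) * (h q - (h q)^-1) ^+ 2 by rewrite mul1r.
have bcS : bs * cs = - (h us * h ws) * ((h q)^-1 - (h q)^-1^-1) ^+ 2 by rewrite mulrC divfK.
have td1 : td_rel (h q) (h u) (h w) A' S' by apply: map_td_rel.
have td2 : td_rel (h q)^-1 (h us) (h ws) S' A'.
  by have := map_td_rel g tdS; rewrite fmorphV.
have hus0 : h us != 0 by rewrite fmorph_eq0.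
have bs0 : bs != 0 by [].
have qk2 : (h q)^-1 ^+ k.+1.*2 != 1 by rewrite exprVn invr_eq1 hqn.
have hqi0 : (h q)^-1 != 0 by rewrite invr_eq0.
have rkS := rank_one_step hqi0 hqV1 bs0 bcS hus0 qk2 tauS' rk'.
lazy zeta in rkS; move: rkS.
set m11 := h us * _; set m12 := qint _ _ * bs; set r := _ / m11 => rkS.
set Q := h q in hq0 hq1 hqn *; set a := Q ^+ k.
have a0 : a != 0 by rewrite expf_neq0.
set e := Q * a - (Q * a)^-1.
have e0 : e != 0.
  by rewrite /e /a -exprS /Q -rmorphXn -fmorphV -rmorphB fmorph_eq0 q_qV.
have m11E : m11 = - h us / a * e.
  rewrite /m11 /e -muln2 exprS exprM !exprVn -/a.
  by move: (a) a0 => x x0; field; rewrite hq0 x0 ?oner_neq0.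
have m110 : m11 != 0 by rewrite m11E !mulf_neq0 ?oppr_eq0 ?invr_eq0.
have QQ : Q - Q^-1 != 0.
  by have := q_qV (isT : 0 < 1)%N; rewrite expr1 -(fmorph_eq0 h) rmorphB fmorphV.
have qkE : qint Q^-1 k.+1 = e / (Q - Q^-1) by rewrite qintV /qint exprS.
have m12r : m12 * r = h ws * a * e.
  rewrite /m12 /r mulrA mulrACA qkE bcS m11E.
  rewrite (_ : Q^-1 - Q^-1^-1 = - (Q - Q^-1)); last by rewrite invrK opprB.
  move: (Q - Q^-1) (e) (a) QQ e0 a0 => x e' a' x0 e'0 a'0.
  by field; rewrite e'0 a'0 oppr_eq0 hus0 x0.
pose Dk := e * (h ws * a - h us / a).
have DE : m11 + m12 * r = Dk by rewrite m12r m11E /Dk; move: (h us) => x; field.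
have hDk : h (D k) = h ws * a - h us / a by rewrite rmorphB !rmorphM fmorphV rmorphXn.
have Dk0 : Dk != 0 by rewrite /Dk mulf_neq0 // -hDk fmorph_eq0 D0.
have lvE : (rowb l' m11 m12 *m colb v' r) 0 0 = Dk * g ((l *m v) 0 0).
  by rewrite rowb_colb DE mxE -map_mxM !mxE.
exists L', h, (n + n.+1)%N, (blkA Q 1 c A'), (blkA Q^-1 bs cs S'), (colb v' r), (rowb l' m11 m12).
split.
- split; rewrite tau_blk ?oner_neq0 // ?tauA' ?tauS' /dia blk0 ?mul0r //.
- split.
    have H := @tridiag_blk L' n Q 1 c bs cs A' S' hq0; rewrite mul1r in H.
    exact: (H td1).
  have H := @tridiag_blk L' n Q^-1 bs cs 1 c S' A' hqi0; rewrite bcS in H.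
  have -> : blkA Q 1 c A' = blkA Q^-1^-1 1 c A' by rewrite invrK.
  exact: (H td2).
- exact: rkS.
- by rewrite lvE mulf_neq0 // fmorph_eq0.
pose X := corner_val (lev (f q) (f u) (f w) k) A v l.
(* [z] enters the new corner values only through [y = cs + c bs]: the products [m11] and [m12 r] are
   free of it. *)
pose y := g (nrm (f q)^-1 (f us) (f ws)) / z + g (nrm (f q) (f u) (f w)) * z.
apply: (@alg_indep_step K L L' f g k X _ y (p k) (s k) (t k)).
- by rewrite /X /corner_val /tau big_ord0 mulmx1 divff.
- by rewrite /X /corner_val tauA mulmx0 mul0mx mxE mul0r.
- exact: ind.
- by move=> i; apply: p0.
- exact: s0.
- apply: ztr; apply: mulf_neq0; first by rewrite oppr_eq0; apply: mulf_neq0; rewrite fmorph_eq0.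
  rewrite expf_neq0 // -fmorphV -rmorphB fmorph_eq0.
  by have := q_qV (isT : 0 < 1)%N; rewrite expr1.
move=> i ik; rewrite /corner_val lvE.
have cE : c = g (nrm (f q) (f u) (f w)).
  by rewrite /nrm !(rmorphN, rmorphM, rmorphXn, rmorphB, fmorphV).
have csE : cs = g (nrm (f q)^-1 (f us) (f ws)) / z.
  by rewrite /cs /nrm !(rmorphN, rmorphM, rmorphXn, rmorphB, fmorphV).
have xr : m11 * r = qint Q k.+1 * cs by rewrite /r mulrC divfK // qintV.
have lE : forall B : 'M[L]_n.+1, (l' *m map_mx g B *m v') 0 0 = g ((l *m B *m v) 0 0).
  by move=> B; rewrite /l' /v' -!map_mxM mxE.
have addE (x1 x2 : L') (M1 M2 : 'M[L']_1) : (x1 *: M1 + x2 *: M2) 0 0 = x1 * M1 0 0 + x2 * M2 0 0.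
  by rewrite !mxE.
rewrite corner_step ?oner_neq0 // addE -!tauE !lE DE xr m12r m11E.
have hp : h (p k i) = (h ws * a / Q ^+ i.+1 - h us * Q ^+ i.+1 / a) / (h ws * a - h us / a).
  by rewrite -hDk fmorph_div rmorphB !fmorph_div !rmorphM !rmorphXn.
have hs : h (s k i) = qint Q i.+1 * qint Q k.+1 / Dk.
  rewrite fmorph_div (rmorphM h (qint _ _)) (rmorphM h _ (D k)) !rmorph_qint.
  rewrite -/(h (D k)) hDk; congr (_ / (_ * _)).
  by rewrite rmorphB fmorphV rmorphXn /e /a exprS.
have ht : h (t k i) = h (p k i) * lev Q (h u) (h w) k i + lev_shift Q (h u) (h w) k i.
  by rewrite rmorphD rmorphM rmorph_lev rmorph_lev_shift.
have yE : y = cs + c * bs by rewrite /y csE cE.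
rewrite (rmorphM g (f _)) -[g (f (p k i))]/(h (p k i)).
rewrite -[g (f (s k i))]/(h (s k i)) -[g (f (t k i))]/(h (t k i)).
rewrite ht hs hp yE /X /corner_val !fmorph_div mul1r /m12 qintV -/Q.
have b0 : Q ^+ i.+1 != 0 by rewrite expf_neq0.
have w0' : h ws * a - h us / a != 0 by rewrite -hDk fmorph_eq0 D0.
have lv0' : g ((l *m v) 0 0) != 0 by rewrite fmorph_eq0.
rewrite /Dk.
move: (g ((l *m tau _ i.+1 A *m v) 0 0)) (g ((l *m tau _ i A *m v) 0 0)).
move: (g ((l *m v) 0 0)) lv0' => lv lv0' G1 G0.
move: (lev _ _ _ _ _) (lev_shift _ _ _ _ _) (qint Q i.+1) (qint Q k.+1) => t1 t2 qi qk.
move: (Q ^+ i.+1) b0 => b b0.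
move: (h us) (h ws) (a) (e) a0 e0 w0' => us' ws' a' e' a0' e0' w0'.
move: (cs) (c) (bs) => cs' c' bs'.
have w1 : ws' * a' * a' - us' != 0.
  rewrite (_ : _ - _ = a' * (ws' * a' - us' / a')); first exact: mulf_neq0.
  by field.
by field; rewrite lv0' a0' w1 b0 e0'.
Qed.

Lemma rep_all : rep d.
Proof.
suff H k : (k <= d)%N -> rep k by apply: H.
elim: k => [|k IH] kd; first exact: rep0.
by apply: rep_step => //; apply: IH; apply: ltnW.
Qed.

End Rep.

(** * Idempotents and band relations from the tridiagonal relations *)

Section Lagrange.
Variables (L : fieldType) (R : algType L) (d : nat) (th : nat -> L) (A : R).
Hypothesis th_inj : forall i j, (i <= d)%N -> (j <= d)%N -> i != j -> th i != th j.
Hypothesis tauA : tau th d.+1 A = 0.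

Definition lag (i : nat) : {poly L} :=
  (\prod_(j < d.+1 | (j : nat) != i) (th i - th j))^-1 *:
  \prod_(j < d.+1 | (j : nat) != i) ('X - (th j)%:P).
Definition idem (i : nat) : R := horner_alg A (lag i).

Lemma horner_alg_tau i : tau th i A = horner_alg A (\prod_(j < i) ('X - (th j)%:P)).
Proof.
rewrite rmorph_prod; apply: eq_bigr => j _.
by rewrite rmorphB /= horner_algX horner_algC.
Qed.

(** A difference vanishing at all [th i] is a multiple of the product of the [X - th i], which kills
    [A]. Identities between the idempotents thus reduce to values at the eigenvalues. *)
Lemma horner_alg_eq (p p' : {poly L}) :
  (forall i, (i <= d)%N -> p.[th i] = p'.[th i]) -> horner_alg A p = horner_alg A p'.
Proof.
move=> E; apply/eqP; rewrite -subr_eq0 -rmorphB.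
have : \prod_(z <- [seq th j | j <- index_iota 0 d.+1]) ('X - z%:P) %| p - p'.
  apply: uniq_roots_dvdp.
    apply/allP => z /mapP[j]; rewrite mem_index_iota => /andP[_ jd] ->.
    by rewrite /root hornerD hornerN E ?subrr.
  rewrite uniq_rootsE map_inj_in_uniq ?iota_uniq // => i j.
  rewrite !mem_index_iota => /andP[_ id] /andP[_ jd] ij.
  apply/eqP; apply: contraTT isT => nij.
  by have := th_inj id jd nij; rewrite ij eqxx.
case/dvdpP => r ->.
rewrite rmorphM [X in _ * X](_ : _ = 0) ?mulr0 //.
by rewrite big_map big_mkord -tauA horner_alg_tau.
Qed.

Lemma lag_eval i k : (i <= d)%N -> (k <= d)%N -> (lag i).[th k] = (i == k)%:R.
Proof.
move=> id kd; rewrite /lag hornerZ horner_prod.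
under [X in _ * X]eq_bigr do rewrite hornerXsubC.
case: eqP => [->|/eqP ik].
  rewrite mulVf //; apply/prodf_neq0 => j jk; rewrite subr_eq0.
  by apply: th_inj; rewrite // -1?ltnS // eq_sym.
by rewrite [X in _ * X](bigD1 (inord k)) /= inordK // 1?eq_sym // subrr mul0r mulr0.
Qed.

Lemma idem_orth : orthogonal_idempotents d idem.
Proof.
move=> i j id jd; rewrite /idem -rmorphM.
case: eqP => [<-|/eqP ij].
  apply: horner_alg_eq => k kd; rewrite hornerM !lag_eval //; case: eqP; rewrite ?mulr1 ?mulr0 //.
rewrite -[RHS](rmorph0 (horner_alg A)); apply: horner_alg_eq => k kd.
rewrite hornerM !lag_eval // horner0; case: (eqVneq i k) => [<-|]; rewrite ?mul0r //.
by rewrite eq_sym (negbTE ij) mulr0.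
Qed.

Lemma idem_sum_poly (p : {poly L}) : \sum_(i < d.+1) p.[th i] *: idem i = horner_alg A p.
Proof.
rewrite /idem; under eq_bigr do rewrite -[_ *: _]mulr_algl -(horner_algC A) -rmorphM.
rewrite -rmorph_sum; apply: horner_alg_eq => k kd; rewrite horner_sum.
rewrite (bigD1 (inord k)) //= big1 => [|j jk].
  by rewrite addr0 hornerM hornerC inordK // lag_eval // eqxx mulr1.
have jk' : (j : nat) != k by apply: contraNneq jk => E; rewrite -val_eqE /= inordK // E.
by rewrite hornerM lag_eval -1?ltnS // (negbTE jk') mulr0.
Qed.

Lemma idem_sum : \sum_(i < d.+1) idem i = 1.
Proof.
have := idem_sum_poly 1; rewrite rmorph1 => <-.
by apply: eq_bigr => i _; rewrite hornerC scale1r.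
Qed.

Lemma idem_sum_th : \sum_(i < d.+1) th i *: idem i = A.
Proof.
have := idem_sum_poly 'X; rewrite horner_algX => <-.
by apply: eq_bigr => i _; rewrite hornerX.
Qed.

Lemma mul_idem i : (i <= d)%N -> A * idem i = th i *: idem i /\ idem i * A = th i *: idem i.
Proof.
move=> id; have E : horner_alg A ('X * lag i) = th i *: idem i.
  rewrite /idem -mulr_algl -(horner_algC A) -rmorphM; apply: horner_alg_eq => k kd.
  rewrite !hornerM hornerX hornerC lag_eval //; case: eqP => [->//|_]; by rewrite !mulr0.
split; first by rewrite -E rmorphM /= horner_algX.
by rewrite -E mulrC rmorphM /= horner_algX.
Qed.

(** Up to scale, [tau_d] is the Lagrange polynomial of the last point. Applied to [S], whose
    eigenvalues are listed in reverse, it makes [es 0] a multiple of [v *m l]. *)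
Lemma idem_last : idem d = (\prod_(j < d) (th d - th j))^-1 *: tau th d A.
Proof.
rewrite /idem /lag horner_alg_tau -[RHS]mulr_algl -(horner_algC A) -rmorphM mul_polyC.
have E (G : nat -> L) : \prod_(j < d.+1 | (j : nat) != d) G j = \prod_(j < d) G j.
  rewrite big_mkcond big_ord_recr /= eqxx mulr1; apply: eq_bigr => j _.
  by rewrite ltn_eqF.
have E' (G : nat -> {poly L}) : \prod_(j < d.+1 | (j : nat) != d) G j = \prod_(j < d) G j.
  rewrite big_mkcond big_ord_recr /= eqxx mulr1; apply: eq_bigr => j _.
  by rewrite ltn_eqF.
by rewrite (E (fun j => th d - th j)) (E' (fun j => 'X - (th j)%:P)).
Qed.

End Lagrange.

(** Multiplied by eigenvectors [e] and [f] on its two sides, the cubic relation becomes this nonzero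
    scalar times [e * S * f]. *)
Lemma tridiag_vanish (L : fieldType) (R : algType L) (c rho x y : L) (A S e f : R) :
  tridiag c rho A S = 0 -> e * A = x *: e -> A * f = y *: f ->
  (x - y) * (x ^+ 2 - (c - 1) * (x * y) + y ^+ 2 - rho) != 0 -> e * S * f = 0.
Proof.
move=> td eA Af n0.
pose Z := e * S * f.
have eA2 : e * A * A = x ^+ 2 *: e by rewrite eA -scalerAl eA scalerA.
have eA3 : e * A * A * A = x ^+ 3 *: e by rewrite eA2 -scalerAl eA scalerA -exprSr.
have Af2 : A * (A * f) = y ^+ 2 *: f by rewrite Af -scalerAr Af scalerA.
have Af3 : A * (A * (A * f)) = y ^+ 3 *: f by rewrite Af2 -scalerAr Af scalerA -exprSr.
have t1 : e * (A * A * A * S) * f = x ^+ 3 *: Z by rewrite !mulrA eA3 -!scalerAl.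
have t2 : e * (A * A * S * A) * f = x ^+ 2 *: (y *: Z).
  by rewrite !mulrA eA2 -!scalerAl -[_ * A * f]mulrA Af -scalerAr.
have t3 : e * (A * S * A * A) * f = x *: (y ^+ 2 *: Z).
  by rewrite !mulrA eA -!scalerAl -[_ * A * f]mulrA -[_ * A * _]mulrA Af2 -scalerAr.
have t4 : e * (S * A * A * A) * f = y ^+ 3 *: Z.
  by rewrite !mulrA -[_ * A * f]mulrA -[_ * A * _]mulrA -[_ * A * _]mulrA Af3 -scalerAr.
have t5 : e * (A * S) * f = x *: Z by rewrite !mulrA eA -!scalerAl.
have t6 : e * (S * A) * f = y *: Z by rewrite !mulrA -[_ * A * f]mulrA Af -scalerAr.
have := congr1 (fun T => e * T * f) td.
rewrite /tridiag !(mulrBr, mulrDr, mulrBl, mulrDl, =^~ scalerAr, =^~ scalerAl).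
rewrite t1 t2 t3 t4 t5 t6 mulr0 mul0r !(scalerBr, scalerA).
rewrite -!(scalerBl, scalerDl).
set k := (_ - _ - _) => /eqP; rewrite scaler_eq0 => /orP[/eqP kE|/eqP //].
have E : (x - y) * (x ^+ 2 - (c - 1) * (x * y) + y ^+ 2 - rho) = k by rewrite /k; ring.
by move: n0; rewrite E kE eqxx.
Qed.

(** Inserting the sum of the idempotents between factors, each factor [A] moves the index by at most
    one. *)
Lemma exp_band (L : fieldType) (R : algType L) (d : nat) (e : nat -> R) (A : R) :
  orthogonal_idempotents d e -> \sum_(i < d.+1) e i = 1 ->
  (forall i j, (i <= d)%N -> (j <= d)%N -> (i.+1 < j)%N || (j.+1 < i)%N -> e i * A * e j = 0) ->
  forall k i j, (i <= d)%N -> (j <= d)%N -> (k + i < j)%N || (k + j < i)%N ->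
    e i * A ^+ k * e j = 0.
Proof.
move=> eo e1 tri; elim=> [|k IH] i j id jd kij.
  by rewrite expr0 mulr1 eo //; case: eqP => // E; move: kij; rewrite E; lia.
rewrite exprSr -[A in _ ^+ k * A]mul1r -e1 mulr_suml mulr_sumr mulr_sumr mulr_suml big1 // => l _.
have ld : (l <= d)%N by rewrite -ltnS.
have -> : e i * (A ^+ k * (e l * A)) * e j = (e i * A ^+ k * e l) * (A * e j) by rewrite !mulrA.
have [H|H] := boolP ((k + i < l)%N || (k + l < i)%N); first by rewrite IH // mul0r.
rewrite -mulrA [e l * _]mulrA tri ?mulr0 //; lia.
Qed.

Lemma lev_diff (L : fieldType) (q u w : L) k i j : q != 0 ->
  lev q u w k i - lev q u w k j =
  ((q ^+ i) ^+ 2 - (q ^+ j) ^+ 2) / q ^+ k * (u - w * (q ^+ k) ^+ 2 / (q ^+ (i + j)) ^+ 2).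
Proof.
move=> q0; rewrite /lev exprD.
move: (q ^+ i) (q ^+ j) (q ^+ k) (expf_neq0 i q0) (expf_neq0 j q0) (expf_neq0 k q0).
move=> x y z x0 y0 z0.
by field; rewrite x0 y0 z0.
Qed.

(** The quadratic factor equals [(lev i - lev (j+1)) (lev i - lev (j-1))], so it can vanish only at
    neighbours. As [j + 1] and [j - 1] may leave the range [0, d], injectivity is applied to the
    factors given by [lev_diff] instead. *)
Lemma lev_band_neq0 (L : fieldType) (q u w : L) d i j :
  q != 0 -> (forall m, (0 < m)%N -> q ^+ m != 1) ->
  (forall i j, (i <= d)%N -> (j <= d)%N -> i != j -> lev q u w d i != lev q u w d j) ->
  (i <= d)%N -> (j <= d)%N -> (i.+1 < j)%N || (j.+1 < i)%N ->
  (lev q u w d i - lev q u w d j) *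
   (lev q u w d i ^+ 2 - (q ^+ 2 + 1 + q^-1 ^+ 2 - 1) * (lev q u w d i * lev q u w d j)
     + lev q u w d j ^+ 2
     - (q + q^-1) ^+ 2 * nrm q u w) != 0.
Proof.
move=> q0 qn inj id jd ij.
(* Every [s] strictly between 0 and [2 d] is a sum of two distinct indices in [0, d], and the factor
   of [lev_diff] in question depends on their sum only. *)
have nz s : (0 < s)%N -> (s < d.*2)%N -> u - w * (q ^+ d) ^+ 2 / (q ^+ s) ^+ 2 != 0.
  move=> s0 sd.
  have [i' [j' [id' jd' ij' <-]]] :
      exists i' j', [/\ (i' <= d)%N, (j' <= d)%N, i' != j' & (i' + j')%N = s].
    have [sd'|sd'] := leqP s d; first by exists 0%N, s; split; lia.
    by exists (s - d)%N, d; split; lia.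
  have := inj i' j' id' jd' ij'; rewrite -subr_eq0 lev_diff //.
  by apply: contraNneq => ->; rewrite mulr0.
have qd x y : (x < y)%N -> (q ^+ x) ^+ 2 != (q ^+ y) ^+ 2.
  move=> xy; have := @qn ((y - x) * 2)%N ltac:(lia); apply: contraNneq => E.
  have E' : q ^+ y = q ^+ x * q ^+ (y - x) by rewrite -exprD subnKC // ltnW.
  move: E; rewrite E' exprMn -[X in X = _]mulr1 => /mulfI; rewrite exprM => -> //.
  by rewrite !expf_neq0.
have qd' x y : x != y -> (q ^+ x) ^+ 2 - (q ^+ y) ^+ 2 != 0.
  by rewrite neq_ltn subr_eq0 => /orP[/qd //|/qd]; rewrite eq_sym.
have ij' : i != j by apply: contraTneq ij => ->; lia.
apply: mulf_neq0; first by rewrite subr_eq0 inj.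
have E : lev q u w d i ^+ 2 - (q ^+ 2 + 1 + q^-1 ^+ 2 - 1) * (lev q u w d i * lev q u w d j)
     + lev q u w d j ^+ 2
     - (q + q^-1) ^+ 2 * nrm q u w =
   ((q ^+ i) ^+ 2 - (q ^+ j.+1) ^+ 2) / q ^+ d * (u - w * (q ^+ d) ^+ 2 / (q ^+ (i + j).+1) ^+ 2) *
   (((q ^+ i.+1) ^+ 2 - (q ^+ j) ^+ 2) / (q ^+ 2 * q ^+ d) * (u - w * (q ^+ d) ^+ 2 / (q ^+ (i + j).-1) ^+ 2)).
  have -> : q ^+ (i + j).-1 = q ^+ (i + j) / q.
    have {2}-> : (i + j = (i + j).-1.+1)%N by lia.
    by rewrite exprSr mulfK.
  rewrite !exprS exprD /lev /nrm.
  move: (q ^+ i) (q ^+ j) (q ^+ d) (expf_neq0 i q0) (expf_neq0 j q0) (expf_neq0 d q0).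
  move=> x y z x0 y0 z0.
  by field; rewrite x0 y0 z0 q0.
rewrite E; repeat apply: mulf_neq0; rewrite ?invr_eq0 ?mulf_neq0 ?expf_neq0 //.
all: by [apply: qd'; lia | apply: nz; lia].
Qed.

Lemma lev_rev (L : fieldType) (q u w : L) d i : q != 0 -> (i <= d)%N ->
  lev q^-1 u w d (d - i) = lev q u w d i.
Proof.
move=> q0 id; have E : q ^+ d = q ^+ (d - i) * q ^+ i by rewrite -exprD subnK.
rewrite /lev !exprVn E.
move: (q ^+ i) (q ^+ (d - i)) (expf_neq0 i q0) (expf_neq0 (d - i) q0) => x y x0 y0.
by field; rewrite ?x0 ?y0 ?oner_neq0.
Qed.

Section Generic.
Variables (L : fieldType) (q u w us ws : L) (d n : nat).
Variables (A S : 'M[L]_n.+1) (v : 'cV[L]_n.+1) (l : 'rV[L]_n.+1) (al als : L).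
Hypothesis q0 : q != 0.
Hypothesis qn : forall m, (0 < m)%N -> q ^+ m != 1.
Let Th i := al + lev q u w d i.
Let Ths i := als + lev q us ws d i.
Hypothesis Th_inj : forall i j, (i <= d)%N -> (j <= d)%N -> i != j -> Th i != Th j.
Hypothesis Ths_inj : forall i j, (i <= d)%N -> (j <= d)%N -> i != j -> Ths i != Ths j.
Hypothesis tauA : tau (lev q u w d) d.+1 A = 0.
Hypothesis tauS : tau (lev q^-1 us ws d) d.+1 S = 0.
Hypothesis tdA : td_rel q u w A S.
Hypothesis tdS : td_rel q^-1 us ws S A.
Hypothesis rk : tau (lev q^-1 us ws d) d S = v *m l.
Hypothesis lv0 : (l *m v) 0 0 != 0.

Let a := A + al%:A.
Let as_ := S + als%:A.
Let e i := idem d (lev q u w d) A i.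
Let es i := idem d (lev q^-1 us ws d) S (d - i).

Let lev_inj i j : (i <= d)%N -> (j <= d)%N -> i != j -> lev q u w d i != lev q u w d j.
Proof. by move=> id jd ij; have := Th_inj id jd ij; rewrite /Th (inj_eq (addrI _)). Qed.

Let levs_inj i j : (i <= d)%N -> (j <= d)%N -> i != j -> lev q^-1 us ws d i != lev q^-1 us ws d j.
Proof.
move=> id jd ij.
have H x : (x <= d)%N -> lev q^-1 us ws d x = lev q us ws d (d - x).
  by move=> xd; rewrite -{1}(subKn xd) lev_rev // leq_subr.
rewrite !H //; have := @Ths_inj (d - i) (d - j) (leq_subr _ _) (leq_subr _ _).
by rewrite /Ths (inj_eq (addrI _)); apply; lia.
Qed.

Let es_orth : orthogonal_idempotents d es.
Proof.
move=> i j id jd; rewrite /es idem_orth ?leq_subr //.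
have -> : (d - i == d - j)%N = (i == j) by lia.
by case: ifP.
Qed.

Let sum_es (c : nat -> L) :
  \sum_(i < d.+1) c i *: es i = \sum_(i < d.+1) c (d - i)%N *: idem d (lev q^-1 us ws d) S i.
Proof.
rewrite (reindex_inj rev_ord_inj); apply: eq_bigr => i _ /=.
by rewrite subSS /es subKn // -ltnS.
Qed.

Let sum_es1 : \sum_(i < d.+1) es i = 1.
Proof.
have := sum_es (fun _ => 1); under eq_bigr do rewrite scale1r.
move=> ->; under eq_bigr do rewrite scale1r.
exact: idem_sum.
Qed.

Let e_orth : orthogonal_idempotents d e. Proof. exact: idem_orth. Qed.
Let sum_e1 : \sum_(i < d.+1) e i = 1. Proof. exact: idem_sum. Qed.

Let es_a i j : (i <= d)%N -> (j <= d)%N -> (i.+1 < j)%N || (j.+1 < i)%N -> es i * a * es j = 0.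
Proof.
move=> id jd ij; rewrite /a mulrDr mulrDl -scalerAr mulr1 -scalerAl es_orth //.
have -> : (i == j) = false by lia.
rewrite scaler0 addr0; apply: (tridiag_vanish tdS).
- by apply: (mul_idem levs_inj tauS _).2; apply: leq_subr.
- by apply: (mul_idem levs_inj tauS _).1; apply: leq_subr.
apply: lev_band_neq0 => //; rewrite ?invr_eq0 ?leq_subr //; last lia.
by move=> m m0; rewrite exprVn invr_eq1 qn.
Qed.

Let e_as i j : (i <= d)%N -> (j <= d)%N -> (i.+1 < j)%N || (j.+1 < i)%N -> e i * as_ * e j = 0.
Proof.
move=> id jd ij; rewrite /as_ mulrDr mulrDl -scalerAr mulr1 -scalerAl e_orth //.
have -> : (i == j) = false by lia.
rewrite scaler0 addr0; apply: (tridiag_vanish tdA).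
- by apply: (mul_idem lev_inj tauA _).2.
- by apply: (mul_idem lev_inj tauA _).1.
by apply: lev_band_neq0.
Qed.

Lemma generic_LP_rels : LP_rels d Th Ths a e as_ es.
Proof.
have dist (i j k : nat) : (k < `|(i : int) - (j : int)|)%N -> (k + i < j)%N || (k + j < i)%N.
  by lia.
split; first by move=> i j; rewrite e_orth -1?ltnS.
split; first by move=> i j; rewrite es_orth -1?ltnS.
split; first exact: sum_e1.
split; first exact: sum_es1.
split.
  rewrite /Th; under eq_bigr do rewrite scalerDl.
  rewrite big_split /= -scaler_sumr sum_e1 addrC; congr (_ + _).
  by rewrite (idem_sum_th lev_inj tauA).
split.
  rewrite /Ths; under eq_bigr do rewrite scalerDl.
  rewrite big_split /= -scaler_sumr sum_es1 addrC; congr (_ + _).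
  rewrite (sum_es (lev q us ws d)) -[LHS](idem_sum_th levs_inj tauS); apply: eq_bigr => i _.
  by rewrite -[in RHS]lev_rev ?leq_subr // subKn // -ltnS.
move=> i j k /dist ijk; split.
  by apply: (exp_band es_orth sum_es1 es_a); rewrite -1?ltnS.
by apply: (exp_band e_orth sum_e1 e_as); rewrite -1?ltnS.
Qed.

Let c0 := (\prod_(j < d) (lev q^-1 us ws d d - lev q^-1 us ws d j))^-1.

Let es0E : es 0%N = c0 *: (v *m l).
Proof. by rewrite /es subn0 idem_last rk. Qed.

Let c00 : c0 != 0.
Proof.
rewrite invr_eq0; apply/prodf_neq0 => j _; rewrite subr_eq0 levs_inj //; first exact: ltnW.
by rewrite gtn_eqF.
Qed.

Let vl0 : v *m l != 0.
Proof.
apply: contraNneq lv0 => E; have : l *m (v *m l) *m v = 0 by rewrite E mulmx0 mul0mx.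
rewrite -!mulmxA mulmxA [l *m v]mx11_scalar mul_scalar_mx => /(congr1 (fun M : 'M_1 => M 0 0)).
by rewrite !mxE eqxx mulr1n => /eqP; rewrite mulf_eq0 orbb.
Qed.

Lemma generic_es0_neq0 : es 0%N != 0.
Proof. by rewrite es0E scaler_eq0 negb_or c00 vl0. Qed.

(** Since [es 0] is a multiple of [v *m l], cutting any matrix down by it gives a scalar multiple of
    [es 0]; idempotence fixes the normalization [c0 * (l *m v) = 1]. *)
Lemma generic_corner j :
  corner Th es a j = corner_val (lev q u w d) A v l j *: es 0%N.
Proof.
have sand (B : 'M[L]_n.+1) : es 0%N * B * es 0%N = (c0 * (l *m B *m v) 0 0) *: es 0%N.
  have vBv : (v *m l) * B * (v *m l) = (l *m B *m v) 0 0 *: (v *m l).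
    rewrite -[LHS]/(v *m l *m B *m (v *m l)) -!mulmxA (mulmxA B) (mulmxA l) (mulmxA l) (mulmxA v).
    by rewrite {1}[l *m B *m v]mx11_scalar mul_mx_scalar -scalemxAl.
  rewrite es0E -scalerAr -!scalerAl vBv !scalerA; congr (_ *: _).
  by rewrite mulrAC -mulrA.
have c0E : c0 * (l *m v) 0 0 = 1.
  have := sand 1; rewrite mulr1 mulmx1 es_orth // eqxx => /esym /eqP.
  rewrite -subr_eq0 -[X in _ - X]scale1r -scalerBl scaler_eq0 (negbTE generic_es0_neq0) orbF subr_eq0.
  by move=> /eqP.
rewrite /corner sand /corner_val; congr (_ *: _).
have -> : tau Th j a = tau (lev q u w d) j A.
  by apply: eq_bigr => k _; rewrite /Th /a scalerDl addrKA.
by apply: (canRL (mulfK lv0)); rewrite mulrAC c0E mul1r.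
Qed.

End Generic.

(** * Choice of the parameters *)

Section Place.
Variables (F K : fieldType) (iota : {rmorphism F -> K}) (b : K) (b0 : F).
Hypothesis b_trans : forall f : {poly F}, (map_poly iota f).[b] = 0 -> f = 0.

Let ev : {rmorphism {poly F} -> K} := horner_eval b \o map_poly iota.

Let ev0 f : ev f = 0 -> f = 0. Proof. exact: b_trans. Qed.

(** Evaluation at [b = b0] on fractions in [b] alone. The eigenvalues to be specialized are such
    fractions, so the place need not be extended from F(b) to [K]. *)
Definition residue (x : K) (c : F) := exists f g : {poly F},
  [/\ g.[b0] != 0, x = ev f / ev g & c = f.[b0] / g.[b0]].

Let ev_neq0 g : g.[b0] != 0 -> ev g != 0.
Proof. by apply: contraNneq => /ev0 ->; rewrite horner0. Qed.

Lemma residue_place : place iota residue.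
Proof.
split.
- move=> c [f [g [g0 /esym/eqP]]]; rewrite mulf_eq0 invr_eq0 (negbTE (ev_neq0 g0)) orbF.
  by move=> /eqP /ev0 -> ->; rewrite horner0 mul0r.
- move=> c; exists c%:P, 1; rewrite !hornerC rmorph1 !divr1; split; rewrite ?oner_eq0 //.
  by rewrite /ev /= /horner_eval map_polyC hornerC.
- move=> x y c c' [f [g [g0 -> ->]]] [f' [g' [g'0 -> ->]]].
  have G := ev_neq0 g0; have G' := ev_neq0 g'0.
  exists (f * g' - f' * g), (g * g'); split.
  + by rewrite hornerM mulf_neq0.
  + rewrite rmorphB !rmorphM; move: (ev f) (ev g) (ev f') (ev g') G G' => x1 x2 x3 x4 n2 n4.
    by field; rewrite n2 n4.
  + rewrite hornerD hornerN !hornerM; move: f.[b0] g.[b0] f'.[b0] g'.[b0] g0 g'0 => x1 x2 x3 x4 n2 n4.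
    by field; rewrite n2 n4.
- move=> x y c c' [f [g [g0 -> ->]]] [f' [g' [g'0 -> ->]]].
  exists (f * f'), (g * g'); split.
  + by rewrite hornerM mulf_neq0.
  + by rewrite !rmorphM mulf_div.
  + by rewrite !hornerM mulf_div.
- move=> x c [f [g [g0 -> ->]]]; rewrite mulf_eq0 negb_or => /andP[f0 _].
  by exists g, f; split; rewrite ?invf_div.
Qed.

Lemma residue_gen : residue b b0.
Proof.
exists 'X, 1; rewrite !hornerC hornerX rmorph1 !divr1; split; rewrite ?oner_eq0 //.
by rewrite /ev /= /horner_eval map_polyX hornerX.
Qed.

End Place.

(** [q] is an indeterminate, and [q^2 + 1 + q^-2] is the ratio of [X^4 + X^2 + 1] to [X^2]. The last
    clause will keep the parameters [u] and [w] away from 0. *)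
Lemma quantum_ext (F : fieldType) : exists (K : fieldType) (iota : {rmorphism F -> K}) (q : K),
  [/\ q != 0, (forall m, (0 < m)%N -> q ^+ m != 1),
      (forall f : {poly F}, (map_poly iota f).[q ^+ 2 + 1 + q^-1 ^+ 2] = 0 -> f = 0) &
      (forall x y : F, x != 0 -> q ^+ 2 * iota x != iota y /\ q ^+ 2 * iota y != iota x)].
Proof.
suff gen (K : fieldType) (j : {rmorphism {poly F} -> K}) : injective j ->
    exists (iota : {rmorphism F -> K}) (q : K),
  [/\ q != 0, (forall m, (0 < m)%N -> q ^+ m != 1),
      (forall f : {poly F}, (map_poly iota f).[q ^+ 2 + 1 + q^-1 ^+ 2] = 0 -> f = 0) &
      (forall x y : F, x != 0 -> q ^+ 2 * iota x != iota y /\ q ^+ 2 * iota y != iota x)].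
  exists {fraction {poly F}}; apply: (gen _ (@tofrac {poly F})) => x y /eqP.
  by rewrite tofrac_eq => /eqP.
move=> j_inj; exists (j \o polyC : {rmorphism _ -> _}), (j 'X).
have z0 : j 'X != 0 by rewrite -(rmorph0 j) (inj_eq j_inj) polyX_eq0.
split=> //.
- move=> m m0; rewrite -rmorphXn -(rmorph1 j) (inj_eq j_inj).
  by apply/eqP => /(congr1 (fun p : {poly F} => size p)); rewrite size_polyXn size_poly1; lia.
- pose N : {poly F} := 'X^4 + ('X^2 + 1).
  have sN : size N = 5.
    rewrite /N size_polyDl size_polyXn // (leq_ltn_trans (size_polyD _ _)) //.
    by rewrite size_polyXn size_poly1.
  move=> f fE; apply: (@ratio_transcendental F _ j N 'X^2 j_inj); rewrite ?sN ?size_polyXn //.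
    by rewrite monic_neq0 ?monicXn.
  rewrite -[RHS]fE; congr (_ .[_]).
  rewrite /N !rmorphD !rmorphXn rmorph1 /= exprVn.
  by move: (j 'X) z0 => z z0; field.
move=> x y x0; rewrite -!rmorphXn /= -!rmorphM !(inj_eq j_inj); split.
  apply/eqP => /(congr1 (fun p : {poly F} => p`_2)); rewrite coefMC coefXn eqxx mul1r coefC /= => /eqP.
  by rewrite (negbTE x0).
apply/eqP => /(congr1 (fun p : {poly F} => p`_0)); rewrite coefMC coefXn mul0r coefC /= => /esym /eqP.
by rewrite (negbTE x0).
Qed.

Section Solve.
Variables (F K : fieldType) (iota : {rmorphism F -> K}) (q : K) (d : nat) (th : nat -> F).
Hypothesis q0 : q != 0.

Lemma lev_rec (u w : K) i : lev q u w d i.+3 =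
  lev q u w d i - (q ^+ 2 + 1 + q^-1 ^+ 2) * (lev q u w d i.+1 - lev q u w d i.+2).
Proof.
rewrite /lev !exprS.
move: (q ^+ i) (q ^+ d) (expf_neq0 i q0) (expf_neq0 d q0) => x y x0 y0.
by field; rewrite ?x0 ?y0 ?q0.
Qed.

(** The generic eigenvalues obey the recurrence of the [th i] with [q^2 + 1 + q^-2] in place of
    [beta], so three exact initial values determine all residues. No residue of [al], [u] or [w] is
    involved. *)
Lemma lev_residue (Res : K -> F -> Prop) (beta : F) (al u w : K) :
  place iota Res -> Res (q ^+ 2 + 1 + q^-1 ^+ 2) beta ->
  (forall i, (i < 3)%N -> al + lev q u w d i = iota (th i)) ->
  (forall i, (i.+3 <= d)%N -> th i.+3 = th i - beta * (th i.+1 - th i.+2)) ->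
  forall i, (i <= d)%N -> Res (al + lev q u w d i) (th i).
Proof.
case=> P0 PC PB PM PV Rb init rec; elim/ltn_ind=> i IH id.
case: (ltnP i 3) => [i3|]; first by rewrite init //; apply: PC.
case: i IH id => [|[|[|i]]] // IH id _.
rewrite rec // lev_rec.
have -> : al + (lev q u w d i - (q ^+ 2 + 1 + q^-1 ^+ 2) * (lev q u w d i.+1 - lev q u w d i.+2)) =
   (al + lev q u w d i) - (q ^+ 2 + 1 + q^-1 ^+ 2) * ((al + lev q u w d i.+1) - (al + lev q u w d i.+2)).
  by ring.
by apply: (PB); [apply: IH; lia | apply: (PM) => //; apply: (PB); apply: IH; lia].
Qed.

Hypothesis qn : forall m, (0 < m)%N -> q ^+ m != 1.
Hypothesis q_indep : forall x y : F, x != 0 ->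
  q ^+ 2 * iota x != iota y /\ q ^+ 2 * iota y != iota x.

Lemma lev_solve : th 0%N != th 1%N -> exists al u w : K, [/\ u != 0, w != 0 &
  forall i, (i < 3)%N -> al + lev q u w d i = iota (th i)].
Proof.
move=> th01; pose d0 := th 1%N - th 0%N; pose d1 := th 2%N - th 1%N.
have d00 : d0 != 0 by rewrite subr_eq0 eq_sym.
have [n1 n2] := q_indep d1 d00.
have q1 : q ^+ 2 - 1 != 0 by rewrite subr_eq0 qn.
have q4 : q ^+ 4 - 1 != 0 by rewrite subr_eq0 qn.
(* [U] and [W] solve [U (q^2 - 1) + W (q^-2 - 1) = d0] and
   [q^2 U (q^2 - 1) + q^-2 W (q^-2 - 1) = d1]. *)
pose U := (q ^+ 2 * iota d1 - iota d0) / ((q ^+ 2 - 1) * (q ^+ 4 - 1)).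
pose W := q ^+ 4 * (iota d1 - q ^+ 2 * iota d0) / ((q ^+ 2 - 1) * (q ^+ 4 - 1)).
have y0 : q ^+ d != 0 by rewrite expf_neq0.
exists (iota (th 0%N) - U - W), (U * q ^+ d), (W / q ^+ d); split.
- apply: mulf_neq0 => //; apply: mulf_neq0; first by rewrite subr_eq0.
  by rewrite invr_eq0 mulf_neq0.
- apply: mulf_neq0; last by rewrite invr_eq0.
  apply: mulf_neq0; last by rewrite invr_eq0 mulf_neq0.
  by rewrite mulf_neq0 ?expf_neq0 // subr_eq0 eq_sym.
have levE i : lev q (U * q ^+ d) (W / q ^+ d) d i = U * (q ^+ i) ^+ 2 + W / (q ^+ i) ^+ 2.
  rewrite /lev; move: (q ^+ i) (q ^+ d) (expf_neq0 i q0) y0 => x y x0 y0.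
  by field; rewrite x0 y0.
have E1 : iota (th 1%N) = iota (th 0%N) + iota d0 by rewrite -rmorphD /d0 addrC subrK.
have E2 : iota (th 2%N) = iota (th 0%N) + iota d0 + iota d1.
  by rewrite -E1 -rmorphD /d1 addrC subrK.
case=> [|[|[|//]]] _; rewrite levE ?E2 ?E1 /U /W.
- by rewrite expr0 expr1n divr1 mulr1; ring.
- rewrite expr1; move: (iota d0) (iota d1) (iota (th 0%N)) => x y t; field.
  by rewrite q0 ?q1 ?q4.
- move: (iota d0) (iota d1) (iota (th 0%N)) => x y t; field.
  by rewrite q0 ?q1 ?q4.
Qed.

End Solve.

(** * Assembly of the generic module, the place and the presentation *)

Lemma map_mpoly_lift (K L : fieldType) (f : {rmorphism K -> L}) d (p : {mpoly L[d]}) :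
  (forall m, exists k, p@_m = f k) -> exists p' : {mpoly K[d]}, p = map_mpoly f p'.
Proof.
move=> pf; rewrite (mpolyE p).
elim: (msupp p) => [|m s [p' IH]]; first by exists 0; rewrite big_nil rmorph0.
have [k kE] := pf m; exists (k *: 'X_[m] + p').
by rewrite big_cons IH rmorphD /= map_mpolyZ map_mpolyX kE.
Qed.

Lemma place_ext (F K L : fieldType) (iota : {rmorphism F -> K}) (f : {rmorphism K -> L})
    (Res : K -> F -> Prop) :
  place iota Res -> place (f \o iota) (fun x c => exists2 k, x = f k & Res k c).
Proof.
case=> P0 PC PB PM PV; split.
- by move=> c [k /esym/eqP]; rewrite fmorph_eq0 => /eqP ->; apply: P0.
- by move=> c; exists (iota c) => //; apply: PC.
- by move=> _ _ b c [x -> xb] [y -> yc]; exists (x - y); [rewrite rmorphB | apply: PB].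
- by move=> _ _ b c [x -> xb] [y -> yc]; exists (x * y); [rewrite rmorphM | apply: PM].
- by move=> _ b [x -> xb] b0; exists x^-1; [rewrite fmorphV | apply: PV].
Qed.

Lemma mu_injective (F : fieldType) (d : nat) (th ths : nat -> F) (beta : F)
    (T : algType F) (a : T) (e : nat -> T) (as_ : T) (es : nat -> T) :
  (forall i j : nat, (i <= d)%N -> (j <= d)%N -> i != j -> th i != th j) ->
  (forall i j : nat, (i <= d)%N -> (j <= d)%N -> i != j -> ths i != ths j) ->
  (forall i, (i.+3 <= d)%N -> th i.+3 = th i - beta * (th i.+1 - th i.+2)) ->
  (forall i, (i.+3 <= d)%N -> ths i.+3 = ths i - beta * (ths i.+1 - ths i.+2)) ->
  LP_presented d th ths a e as_ es ->
  forall p : {mpoly F[d]}, mu th a es p = 0 -> p = 0.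
Proof.
move=> thi thsi rec recs pres p mu0.
have [K [iota [q [q0 qn btr qind]]]] := quantum_ext F.
set b := q ^+ 2 + 1 + q^-1 ^+ 2 in btr.
pose Res := residue iota b beta.
have pl : place iota Res := residue_place beta btr.
have Rb : Res b beta := residue_gen iota b beta.
have solve (t : nat -> F) : (forall i j : nat, (i <= d)%N -> (j <= d)%N -> i != j -> t i != t j) ->
    (forall i, (i.+3 <= d)%N -> t i.+3 = t i - beta * (t i.+1 - t i.+2)) ->
    exists al u w : K, [/\ u != 0, w != 0 & forall i, (i <= d)%N -> Res (al + lev q u w d i) (t i)].
  (* [lev_solve] fits three values; those beyond [d] are set so as to differ from [t 0]. *)
  move=> ti trec; pose t' i := if (i <= d)%N then t i else t 0%N + 1.
  have t'01 : t' 0%N != t' 1%N.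
    rewrite /t' /=; case: ifP => [d1|_]; first exact: ti.
    by rewrite -subr_eq0 opprD addNKr oppr_eq0 oner_eq0.
  have [al [u [w [u0 w0 init]]]] := lev_solve d q0 qn qind t'01.
  exists al, u, w; split=> // i id.
  have -> : t i = t' i by rewrite /t' id.
  apply: (lev_residue q0 pl Rb init) => // k kd; rewrite /t' kd.
  have kd2 := ltnW kd; have kd1 := ltnW kd2; have kd0 := ltnW kd1.
  by rewrite kd2 kd1 kd0; apply: trec.
have [al [u [w [u0 w0 ThR]]]] := solve _ thi rec.
have [als [us [ws [us0 ws0 ThsR]]]] := solve _ thsi recs.
have dist (t : nat -> F) (t' : nat -> K) :
    (forall i j : nat, (i <= d)%N -> (j <= d)%N -> i != j -> t i != t j) ->
    (forall i, (i <= d)%N -> Res (t' i) (t i)) ->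
    forall i j : nat, (i <= d)%N -> (j <= d)%N -> i != j -> t' i != t' j.
  move=> ti tR i j id jd ij; case: pl => P0 _ PB _ _.
  apply: contraNneq (ti i j id jd ij) => E; rewrite -subr_eq0; apply/eqP/P0.
  by rewrite -(subrr (t' j)) -{1}E; apply: PB; apply: tR.
have Thi := dist _ _ thi ThR; have Thsi := dist _ _ thsi ThsR.
(* By [lev_diff], the difference of the generic dual eigenvalues at [0] and [d - k] has the factor
   [us - ws q^(2k)]. *)
have nz k : (k < d)%N -> ws * (q ^+ k) ^+ 2 - us != 0.
  move=> kd; have := Thsi 0%N (d - k)%N isT (leq_subr _ _) ltac:(lia).
  rewrite (inj_eq (addrI _)) -subr_eq0 lev_diff // add0n.
  apply: contraNneq => E; rewrite (_ : us - _ = 0) ?mulr0 //.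
  have dE : q ^+ d = q ^+ k * q ^+ (d - k) by rewrite -exprD subnKC // ltnW.
  rewrite dE exprMn mulrA mulfK ?expf_neq0 //.
  by apply/eqP; rewrite subr_eq0 eq_sym -subr_eq0 E.
have [L [f [n [A [S [v [l [[tauA tauS] [tdA tdS] rk lv0 ind]]]]]]]] :=
  rep_all q0 qn u0 w0 us0 ws0 nz.
have fTh i : f al + lev (f q) (f u) (f w) d i = f (al + lev q u w d i).
  by rewrite -rmorph_lev -rmorphD.
have fThs i : f als + lev (f q) (f us) (f ws) d i = f (als + lev q us ws d i).
  by rewrite -rmorph_lev -rmorphD.
have fq0 : f q != 0 by rewrite fmorph_eq0.
have fqn m : (0 < m)%N -> f q ^+ m != 1.
  by move=> m0; rewrite -rmorphXn fmorph_eq1 qn.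
have LTh i j : (i <= d)%N -> (j <= d)%N -> i != j ->
    f al + lev (f q) (f u) (f w) d i != f al + lev (f q) (f u) (f w) d j.
  by move=> id jd ij; rewrite !fTh (inj_eq (fmorph_inj f)) Thi.
have LThs i j : (i <= d)%N -> (j <= d)%N -> i != j ->
    f als + lev (f q) (f us) (f ws) d i != f als + lev (f q) (f us) (f ws) d j.
  by move=> id jd ij; rewrite !fThs (inj_eq (fmorph_inj f)) Thsi.
apply: (mu_inj_from_generic (place_ext f pl) thi thsi _ _
  (generic_LP_rels fq0 fqn LTh LThs tauA tauS tdA tdS lv0)
  (generic_es0_neq0 fq0 LThs rk lv0)
  (fun j : 'I_d => generic_corner _ _ _ _ fq0 LThs tauS rk lv0 j.+1) _ pres mu0).
- by move=> i id; exists (al + lev q u w d i); [rewrite fTh | apply: ThR].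
- by move=> i id; exists (als + lev q us ws d i); [rewrite fThs | apply: ThsR].
(* Elements of the ring of the place come from [K], over which the corner values are independent. *)
move=> g gv g0; have [|g' gE] := @map_mpoly_lift _ _ f d g.
  by move=> m; have [c [k kE _]] := gv m; exists k.
by rewrite gE (ind g') ?rmorph0 // -gE.
Qed.

Theorem theorem12p1 (F : fieldType) (d : nat) (th ths : nat -> F)
    (T : algType F) (a : T) (e : nat -> T) (as_ : T) (es : nat -> T) :
  (d <= 5)%N ->
  (forall i j : nat, (i <= d)%N -> (j <= d)%N -> i != j -> th i != th j) ->
  (forall i j : nat, (i <= d)%N -> (j <= d)%N -> i != j -> ths i != ths j) ->
  (exists beta : F, forall i : nat, (2 <= i)%N -> (i.+1 <= d)%N ->
      (th (i - 2)%N - th i.+1) / (th i.-1 - th i) = beta /\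
      (ths (i - 2)%N - ths i.+1) / (ths i.-1 - ths i) = beta) ->
  LP_presented d th ths a e as_ es ->
  (forall p q : {mpoly F[d]}, mu th a es p = mu th a es q -> p = q) /\
  (forall u : T, exists p : {mpoly F[d]}, mu th a es p = es 0%N * u * es 0%N).
Proof.
move=> _ thi thsi [beta rec] pres; split; last first.
  by case: pres => rels gens _; apply: (mu_surj thi thsi rels gens).
have three_term (t : nat -> F) :
    (forall i j : nat, (i <= d)%N -> (j <= d)%N -> i != j -> t i != t j) ->
    (forall i, (2 <= i)%N -> (i.+1 <= d)%N -> (t (i - 2)%N - t i.+1) / (t i.-1 - t i) = beta) ->
    forall i, (i.+3 <= d)%N -> t i.+3 = t i - beta * (t i.+1 - t i.+2).
  move=> ti trec i id; have := trec i.+2 isT id; rewrite subSS subSS subn0 /= => <-.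
  rewrite divfK ?subKr // subr_eq0; apply: ti; [exact: ltnW (ltnW id) | exact: ltnW id|].
  by rewrite ltn_eqF.
move=> p q pq; apply/eqP; rewrite -subr_eq0; apply/eqP.
apply: (mu_injective thi thsi (three_term _ thi _) (three_term _ thsi _) pres).
- by move=> i i2 id; have [] := rec i i2 id.
- by move=> i i2 id; have [] := rec i i2 id.
by move: pq; rewrite !muE mmapB mulrBr => ->; rewrite subrr.
Qed.
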